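(* Let $\mathcal{M}$ be a matroid of rank $r$ on the ground set $E=\{1,\ldots,n\}$, without loops or coloops and with $2\leq r\leq n-1$. Then the toric ideal $I_{\mathcal{M}}$ is a complete intersection if and only if $n=4$ and, up to relabeling the elements of $E$, $\mathcal{M}$ is the matroid whose set of bases is one of: (1) $\{\{1,2\},\{3,4\},\{1,3\},\{2,4\}\}$; (2) $\{\{1,2\},\{3,4\},\{1,3\},\{2,4\},\{1,4\}\}$; (3) $\{\{1,2\},\{3,4\},\{1,3\},\{2,4\},\{1,4\},\{2,3\}\}$, i.e. $\mathcal{M}$ is the uniform matroid $\mathcal{U}_{2,4}$.
   Context: Let $\mathcal{M}$ be a matroid on $E=\{1,\ldots,n\}$ with set of bases $\mathcal{B}$. Let $k$ be a field, $R=k[y_B \mid B\in\mathcal{B}]$, and $\varphi:R\to k[x_1,\ldots,x_n]$ the $k$-algebra homomorphism with $y_B\mapsto\prod_{i\in B}x_i$. The toric ideal of $\mathcal{M}$ is $I_{\mathcal{M}}=\ker\varphi$. $I_{\mathcal{M}}$ is a complete intersection if its minimal number of generators equals its height. $\mathcal{U}_{r,n}$ denotes the uniform matroid of rank $r$ on $n$ elements.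
   Formalization: A complete intersection is here also required to be a nonzero ideal, because for r = n−1 (e.g. U_{2,3}) the toric ideal is 0, with 0 generators and height 0, and the claim as stated would fail. *)

(* Defs.v *)
From HB Require Import structures.
From mathcomp Require Import all_boot all_order all_algebra all_fingroup.
From mathcomp Require Import mpoly.
Set Implicit Arguments. Unset Strict Implicit. Unset Printing Implicit Defensive.
Import GRing.Theory.
Local Open Scope ring_scope.

(* ---------- Matroids on the ground set 'I_n (element i <-> label i+1) ---- *)
Record matroid (n : nat) := Matroid {
  bases : {set {set 'I_n}};
  bases_nonempty : bases != set0;
  bases_exchange : forall B1 B2, B1 \in bases -> B2 \in bases ->
    forall x, x \in B1 :\: B2 ->
      exists2 y, y \in B2 :\: B1 & (B1 :\ x) :|: [set y] \in bases
}.

Definition has_rank n (M : matroid n) (r : nat) : Prop :=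
  forall B, B \in bases M -> #|B| = r.

Definition is_loop n (M : matroid n) (e : 'I_n) : Prop :=
  forall B, B \in bases M -> e \notin B.
Definition is_coloop n (M : matroid n) (e : 'I_n) : Prop :=
  forall B, B \in bases M -> e \in B.

(* R = k[y_B | B in bases M], variables indexed by 'I_#|bases M| via enum_val *)
Definition basis_monomial (k : fieldType) n (M : matroid n)
    (j : 'I_#|bases M|) : {mpoly k[n]} :=
  \prod_(i in (enum_val j : {set 'I_n})) 'X_i.

Definition toric_map (k : fieldType) n (M : matroid n)
    (p : {mpoly k[#|bases M|]}) : {mpoly k[n]} :=
  mmap (fun c : k => c%:MP) (@basis_monomial k n M) p.

Definition toric_ideal (k : fieldType) n (M : matroid n) :
    {mpoly k[#|bases M|]} -> Prop :=
  fun p => @toric_map k n M p = 0.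

Definition is_ideal (R : comNzRingType) (I : R -> Prop) : Prop :=
  [/\ I 0, (forall a b, I a -> I b -> I (a + b)) &
      (forall r a, I a -> I (r * a))].

Definition is_prime_ideal (R : comNzRingType) (P : R -> Prop) : Prop :=
  [/\ is_ideal P, ~ P 1 & (forall a b, P (a * b) -> P a \/ P b)].

Definition strict_subset (R : Type) (P Q : R -> Prop) : Prop :=
  (forall x, P x -> Q x) /\ exists x, Q x /\ ~ P x.

Definition prime_chain_to (R : comNzRingType) (I : R -> Prop) (h : nat) : Prop :=
  exists P : nat -> R -> Prop,
    [/\ forall i, (i <= h)%N -> is_prime_ideal (P i),
        forall i, (i < h)%N -> strict_subset (P i) (P i.+1) &
        forall x, P h x <-> I x].

Definition ideal_height (R : comNzRingType) (I : R -> Prop) (h : nat) : Prop :=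
  prime_chain_to I h /\ ~ prime_chain_to I h.+1.

Definition generated_by (R : comNzRingType) (I : R -> Prop) (gs : seq R) : Prop :=
  forall x, I x <-> exists c : 'I_(size gs) -> R,
                     x = \sum_(i < size gs) c i * gs`_i.

Definition min_num_gens (R : comNzRingType) (I : R -> Prop) (m : nat) : Prop :=
  (exists2 gs : seq R, size gs = m & generated_by I gs) /\
  (forall gs : seq R, generated_by I gs -> (m <= size gs)%N).

Definition complete_intersection (R : comNzRingType) (I : R -> Prop) : Prop :=
  (exists x, I x /\ x <> 0) /\
  exists h, ideal_height I h /\ min_num_gens I h.

Definition fam1 : seq (seq nat) := [:: [:: 1; 2]; [:: 3; 4]; [:: 1; 3]; [:: 2; 4]]%N.
Definition fam2 : seq (seq nat) :=
  [:: [:: 1; 2]; [:: 3; 4]; [:: 1; 3]; [:: 2; 4]; [:: 1; 4]]%N.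
Definition fam3 : seq (seq nat) :=
  [:: [:: 1; 2]; [:: 3; 4]; [:: 1; 3]; [:: 2; 4]; [:: 1; 4]; [:: 2; 3]]%N.

Definition bases_up_to_relabel n (M : matroid n) (fam : seq (seq nat)) : Prop :=
  exists s : {perm 'I_n}, forall B : {set 'I_n},
    (B \in bases M) =
    has (fun L => B == [set i : 'I_n | (val (s i)).+1 \in L]) fam.

(* Main.v *)
Require Import Defs.
From mathcomp Require Import all_boot all_order all_algebra all_fingroup.
From mathcomp Require Import mpoly zify ring.
From Stdlib Require Import Classical_Prop.
Set Implicit Arguments. Unset Strict Implicit. Unset Printing Implicit Defensive.
Import GRing.Theory.
Local Open Scope ring_scope.

(* Let N be the number of bases and let s be the largest number of binomials y^u - y^v of the toric
   ideal I whose exponent differences u - v are linearly independent over k. N - s of the variables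
   y_B are algebraically independent modulo I, and a prime chain of length h below I adds h further
   elements to them, so that ht I <= s. The gradients of I along the curve (t^r, ..., t^r), which
   lies on the toric variety, span a space of dimension s over k(t). If I is generated by at most s
   elements, their gradients are therefore independent; an element of I with zero gradient along
   the curve is then a combination of the generators with coefficients vanishing at the origin, so
   it has no quadratic part, because I contains no linear forms. Six bases forming a 2 x 3 grid
   contradict this, since the alternating sum of their three 2 x 2 minors has zero gradient.
   If n >= 5 and r <= n - 2, the fundamental graph of a basis contains a pattern that
   produces such a grid; if r = n - 1, then I = 0; and if n = 4, then r = 2 and the matroid is one
   of the three of the list. Conversely, for these three, I is generated by one or two binomials
   and has the corresponding height. *)

(** * Monomials and the toric ideal *)

Section ToricMonomials.
Variables (k : fieldType) (n : nat) (M : matroid n).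
Local Notation N := #|bases M|.
Local Notation I := (@toric_ideal k n M).
Local Notation phi := (@toric_map k n M).

(** The incidence matrix of elements and bases applied to an exponent vector; the binomials of the
    toric ideal are the pairs with equal value. *)
Definition mon_image (u : 'X_{1.. N}) : 'X_{1.. n} :=
  [multinom (\sum_(j < N) (i \in (enum_val j : {set 'I_n})) * u j)%N | i < n].

Lemma mon_imageE u i :
  mon_image u i = (\sum_(j < N) (i \in (enum_val j : {set 'I_n})) * u j)%N.
Proof. by rewrite mnmE. Qed.

Lemma mon_imageD u v : mon_image (u + v)%MM = (mon_image u + mon_image v)%MM.
Proof.
apply/mnmP=> i; rewrite mnmDE !mon_imageE -big_split /=.
by apply: eq_bigr => j _; rewrite mnmDE mulnDr.
Qed.

Lemma mon_imageU j i : mon_image U_(j)%MM i = (i \in (enum_val j : {set 'I_n})).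
Proof.
rewrite mon_imageE (bigD1 j) //= big1 ?addn0 ?mnm1E ?eqxx ?muln1 // => l lj.
by rewrite mnm1E eq_sym (negbTE lj) muln0.
Qed.

(** Summing the incidences basis by basis, each variable contributes [r]. The toric ideal is
    therefore homogeneous when [r] is positive. *)
Lemma mdeg_mon_image r u : has_rank M r -> mdeg (mon_image u) = (r * mdeg u)%N.
Proof.
move=> hr; rewrite !mdegE big_distrr /=.
under eq_bigr => i _ do rewrite mon_imageE.
rewrite exchange_big /=; apply: eq_bigr => j _.
rewrite -big_distrl /= -(hr _ (enum_valP j)) -sum1_card [in RHS]big_mkcond /=.
by congr (_ * _)%N; apply: eq_bigr => i _; case: (i \in _).
Qed.

Lemma basis_monomialE j : basis_monomial k (M:=M) j = 'X_[mon_image U_(j)%MM].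
Proof.
rewrite /basis_monomial mpolyXE_id [RHS](bigID (mem (enum_val j))) /=.
rewrite [X in _ * X]big1 ?mulr1 => [|i /negbTE ij]; last by rewrite mon_imageU ij expr0.
by apply: eq_bigr => i ij; rewrite mon_imageU ij expr1.
Qed.

Lemma toric_mapE p : phi p = mmap (@mpolyC n k) (@basis_monomial k n M) p.
Proof. by []. Qed.

Lemma toric_mapX u : phi 'X_[u] = 'X_[mon_image u].
Proof.
rewrite toric_mapE mmapX /mmap1.
under eq_bigr => j _ do rewrite basis_monomialE mpolyXn.
rewrite -(big_morph _ (@mpolyXD n k) (mpolyX0 n k)); congr 'X_[_]; apply/mnmP=> i.
rewrite mnm_sumE mon_imageE; apply: eq_bigr => j _.
by rewrite mulmnE mon_imageU.
Qed.

Lemma toric_mapD : {morph phi : p q / p + q}.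
Proof. by move=> p q; rewrite !toric_mapE mmapD. Qed.

Lemma toric_mapB : {morph phi : p q / p - q}.
Proof. by move=> p q; rewrite !toric_mapE mmapB. Qed.

Lemma toric_mapM : {morph phi : p q / p * q}.
Proof. by move=> p q; rewrite !toric_mapE rmorphM. Qed.

Lemma toric_mapZ c p : phi (c *: p) = c *: phi p.
Proof. by rewrite !toric_mapE mmapZ mul_mpolyC. Qed.

Lemma toric_map_sum (X : Type) (s : seq X) (P : pred X) F :
  phi (\sum_(x <- s | P x) F x) = \sum_(x <- s | P x) phi (F x).
Proof. by rewrite toric_mapE raddf_sum. Qed.

Lemma toric_ideal_prime : is_prime_ideal I.
Proof.
rewrite /toric_ideal; split.
- split; first by rewrite toric_mapE mmap0.
  + by move=> a b; rewrite toric_mapD => -> ->; rewrite addr0.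
  + by move=> r a; rewrite toric_mapM => ->; rewrite mulr0.
- by rewrite toric_mapE rmorph1; apply/eqP/oner_neq0.
by move=> a b; rewrite toric_mapM => /eqP; rewrite mulf_eq0 => /orP[]/eqP; [left|right].
Qed.

Lemma toric_idealX u v :
  mon_image u = mon_image v -> I ('X_[u] - 'X_[v]).
Proof. by rewrite /toric_ideal toric_mapB !toric_mapX => ->; rewrite subrr. Qed.

Lemma mcoeff_toric_map p a :
  (phi p)@_a = \sum_(u <- msupp p | mon_image u == a) p@_u.
Proof.
rewrite {1}[p]mpolyE toric_map_sum raddf_sum /= [RHS]big_mkcond /=.
apply: eq_bigr => u _; rewrite toric_mapZ toric_mapX mcoeffZ mcoeffX.
by case: eqP; rewrite ?mulr1 ?mulr0.
Qed.

(** A monomial that is alone in its fibre has nothing to cancel against: its coefficient is a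
    coefficient of the image of [g]. *)
Lemma toric_ideal_coeff_eq0 g m :
  (forall u, mon_image u = mon_image m -> u = m) -> I g -> g@_m = 0.
Proof.
move=> inj Ig; have := mcoeff_toric_map g (mon_image m); rewrite Ig mcoeff0.
rewrite (eq_bigl (pred1 m)) => [|u]; last first.
  by apply/eqP/eqP => [/inj|->].
rewrite -big_filter; have [ms|/memN_msupp_eq0->//] := boolP (m \in msupp g).
by rewrite (filter_pred1_uniq (msupp_uniq g) ms) big_seq1.
Qed.

(** Both degrees agree because [r] is positive, and distinct variables stand for distinct bases.
    Hence elements of the ideal have no constant or linear terms. *)
Lemma mon_image_inj_deg1 r u m :
  has_rank M r -> (0 < r)%N -> (mdeg m <= 1)%N -> mon_image u = mon_image m -> u = m.
Proof.
move=> hr r0 m1 E; have := congr1 (@mdeg n) E; rewrite !(mdeg_mon_image _ hr).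
move/eqP; rewrite eqn_pmul2l // => /eqP Eu.
case: (ltngtP (mdeg m) 1%N) m1 => // [m0|m1] _.
  have /eqP: mdeg m = 0%N by case: (mdeg m) m0.
  by rewrite mdeg_eq0 => /eqP m00; move: Eu; rewrite m00 mdeg0 => /eqP; rewrite mdeg_eq0 => /eqP.
have /mdeg1P [i /eqP Em] : mdeg m == 1%N by rewrite m1.
have /mdeg1P [j /eqP Ej] : mdeg u == 1%N by rewrite Eu m1.
rewrite Em Ej; congr U_(_)%MM; apply: enum_val_inj; apply/setP=> x.
have := congr1 (fun w : 'X_{1.. n} => w x) E; rewrite Em Ej !mon_imageU.
by do 2 case: (x \in _).
Qed.

Lemma toric_ideal_coeff_deg1 r g m :
  has_rank M r -> (0 < r)%N -> I g -> (mdeg m <= 1)%N -> g@_m = 0.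
Proof.
move=> hr r0 Ig m1; apply: toric_ideal_coeff_eq0 Ig => u; exact: mon_image_inj_deg1 hr _ _.
Qed.

End ToricMonomials.

(** * Chains of prime ideals *)

Section PrimeChains.
Variables (k : fieldType) (N : nat).
Local Notation R := {mpoly k[N]}.

Definition indep_mod (X : finType) (b : X -> R) (P : R -> Prop) :=
  forall a : X -> k, P (\sum_x a x *: b x) -> forall x, a x = 0.

Lemma ideal_sub (P : R -> Prop) a b : is_ideal P -> P (a + b) -> P b -> P a.
Proof.
by case=> _ PD PM Pab Pb; rewrite -[a](addrK b) -[- b]mulN1r; apply/PD/PM.
Qed.

(** Modulo [Q] only the term without [f] survives, so its coefficients vanish by independence. A
    factor [f] can then be cancelled modulo the prime [P], and the argument repeats. *)
Lemma indep_mod_horner (X : finType) (b : X -> R) (P Q : R -> Prop) f D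
    (a : nat -> X -> k) :
  is_prime_ideal P -> is_ideal Q -> (forall x, P x -> Q x) -> Q f -> ~ P f ->
  indep_mod b Q -> P (\sum_(e < D) (\sum_x a e x *: b x) * f ^+ e) ->
  forall e x, (e < D)%N -> a e x = 0.
Proof.
move=> [idP _ primeP] idQ PQ Qf nPf ib; elim: D a => // D IH a.
rewrite big_ord_recl expr0 mulr1.
under [X in _ + X]eq_bigr => i _ do rewrite lift0 exprSr mulrA.
rewrite -big_distrl /= => Pa; have [_ _ QM] := idQ.
have a0 : forall x, a 0%N x = 0.
  by apply: ib; apply: (ideal_sub idQ (PQ _ Pa)); apply: QM.
move: Pa; rewrite big1 ?add0r => [Pa|x _]; last by rewrite a0 scale0r.
have {}Pa := primeP _ _ Pa; case: Pa => // Pa [|e] x //.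
exact: (IH (fun e => a e.+1)).
Qed.

Lemma indep_mod_pow (X : finType) (b : X -> R) (P Q : R -> Prop) f D :
  is_prime_ideal P -> is_ideal Q -> (forall x, P x -> Q x) -> Q f -> ~ P f ->
  indep_mod b Q -> indep_mod (fun z : X * 'I_D => b z.1 * f ^+ z.2) P.
Proof.
move=> prP idQ PQ Qf nPf ib a Pa [x e].
pose a' (i : nat) y := if insub i is Some j then a (y, j) else 0.
have a'E (i : 'I_D) y : a' i y = a (y, i) by rewrite /a' valK.
rewrite -a'E; apply: (indep_mod_horner (D := D) prP idQ PQ Qf nPf ib) => //.
suff <- : \sum_x a x *: (b x.1 * f ^+ x.2) =
          \sum_(e0 < D) (\sum_x0 a' e0 x0 *: b x0) * f ^+ e0 by [].
under [RHS]eq_bigr => i _ do rewrite big_distrl /=.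
rewrite exchange_big pair_bigA /=; apply: eq_bigr => -[y i] _ /=.
by rewrite a'E scalerAl.
Qed.

(** Independence modulo [P] implies independence in the polynomial ring, and polynomials of degree
    at most [s] involve only monomials with all exponents at most [s]. *)
Lemma indep_mod_card (X : finType) (b : X -> R) (P : R -> Prop) s :
  P 0 -> (forall x, (msize (b x) <= s.+1)%N) -> indep_mod b P -> (#|X| <= s.+1 ^ N)%N.
Proof.
move=> P0 bs ib; pose T := {ffun 'I_N -> 'I_s.+1}.
pose mn (t : T) : 'X_{1.. N} := [multinom (t i : nat) | i < N].
pose A := \matrix_(i < #|X|, j < #|T|) (b (enum_val i))@_(mn (enum_val j)).
suff fA : row_free A.
  have := rank_leq_col A; rewrite (eqP fA) => le.
  by apply: (leq_trans le); rewrite card_ffun !card_ord.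
apply: inj_row_free => v vA.
have S0 : \sum_x v 0 (enum_rank x) *: b x = 0.
  apply/mpolyP=> m; rewrite mcoeff0 raddf_sum /=.
  under eq_bigr => x _ do rewrite mcoeffZ.
  have [ms|ms] := leqP (mdeg m) s; last first.
    rewrite big1 // => x _; rewrite memN_msupp_eq0 ?mulr0 //.
    by apply: msize_mdeg_ge; apply: leq_trans (bs x) ms.
  have mi i : (m i < s.+1)%N.
    by rewrite ltnS (leq_trans _ ms) // mdegE (bigD1 i) //= leq_addr.
  have := congr1 (fun w : 'M_(1, _) => w 0 (enum_rank [ffun i => Ordinal (mi i)])) vA.
  rewrite !mxE => E; rewrite -[RHS]E (reindex (@enum_val X X)) /=; last first.
    by exists enum_rank => x _; rewrite (enum_rankK, enum_valK).
  apply: eq_bigr => i _; rewrite enum_valK mxE enum_rankK; congr (_ * _@__).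
  by apply/mnmP=> j; rewrite mnmE ffunE.
apply/rowP=> i; rewrite mxE -(enum_valK i).
by move: (ib (fun x => v 0 (enum_rank x))); rewrite S0 => /(_ P0).
Qed.

Lemma msize_exp (f : R) e : (msize (f ^+ e) <= (e * (msize f).+1).+1)%N.
Proof.
elim: e => [|e IH]; first by rewrite expr0 msize1.
rewrite exprS (leq_trans (msizeM_le _ _)) // mulSn.
by rewrite -addSn -addnS leq_add.
Qed.

(** An elementary substitute for the quotient by [P] having dimension at least [d]: its Hilbert
    function grows at least like a polynomial of degree [d]. *)
Definition indep_growth (P : R -> Prop) d :=
  exists C, forall D, (0 < D)%N -> exists (X : finType) (b : X -> R),
    [/\ #|X| = (D ^ d)%N, forall x, (msize (b x) <= (D * C).+1)%N & indep_mod b P].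

(** Multiplying the family for [Q] by the first [D] powers of an element of [Q] outside [P] gains a
    factor [D] in size, while degrees stay linear in [D]. *)
Lemma indep_growth_step (P Q : R -> Prop) d :
  is_prime_ideal P -> is_ideal Q -> strict_subset P Q ->
  indep_growth Q d -> indep_growth P d.+1.
Proof.
(* Powers of [f] cost at most [D * (msize f).+1]; the two further units of the constant absorb the
   offsets in the bounds on [msize]. *)
move=> prP idQ [PQ [f [Qf nPf]]] [C HC]; exists (C + (msize f).+3)%N => D D0.
have [X [b [cX sb ib]]] := HC D D0.
exists (X * 'I_D)%type, (fun z : X * 'I_D => b z.1 * f ^+ z.2); split.
- by rewrite card_prod cX card_ord expnSr.
- case=> x e /=; apply: leq_trans (msizeM_le _ _) _; rewrite ltnS.
  apply: (leq_trans (leq_add (sb x) (msize_exp f e))).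
  have := leq_mul (ltnW (ltn_ord e)) (leqnn (msize f).+1).
  by move: (_ * (msize f).+1)%N => t; rewrite mulnDr -[(msize f).+3]addn2 mulnDr; lia.
- exact: indep_mod_pow prP idQ PQ Qf nPf ib.
Qed.

(** Counting gives [D ^ d <= (D * C).+1 ^ N], and the right side is at most [D ^ N * C.+1 ^ N]. If
    [d] exceeded [N], any [D] larger than [C.+1 ^ N] would violate this. *)
Lemma indep_growth_le (P : R -> Prop) d : P 0 -> indep_growth P d -> (d <= N)%N.
Proof.
move=> P0 [C HC]; rewrite leqNgt; apply/negP=> Nd.
pose D := (C.+1 ^ N).+1; have [X [b [cX sb ib]]] := HC D isT.
have := indep_mod_card P0 sb ib; rewrite cX => le.
have le2 : (D ^ N.+1 <= D ^ N * C.+1 ^ N)%N.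
  rewrite -expnMn; apply: leq_trans (leq_trans (leq_pexp2l _ Nd) le) _ => //.
  by case: (N) => // m; rewrite leq_exp2r // mulnS addnC -addn1 leq_add2l.
by move: le2; rewrite expnSr leq_pmul2l ?expn_gt0 // ltnn.
Qed.

(** Descending the chain from [I], each strict inclusion raises the growth exponent by one, and at
    the bottom the exponent is still at most [N]. *)
Lemma prime_chain_growth (I : R -> Prop) h d :
  prime_chain_to I h -> indep_growth I d -> (d + h <= N)%N.
Proof.
case=> P [prP sP hP] gI.
have gP i : (i <= h)%N -> indep_growth (P (h - i)%N) (d + i).
  elim: i => [|i IH] ih.
    rewrite subn0 addn0; case: gI => C HC; exists C => D /HC [X [b [cX sb ib]]].
    by exists X, b; split => // a /hP; apply: ib.
  rewrite addnS; apply: indep_growth_step (IH (ltnW ih)).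
  - exact/prP/leq_subr.
  - by have [] := prP (h - i)%N (leq_subr _ _).
  - have -> : (h - i = (h - i.+1).+1)%N by rewrite subnS prednK ?subn_gt0.
    by apply: sP; rewrite ltn_subrL; case: (h) ih.
have := gP h (leqnn h); rewrite subnn; apply: indep_growth_le.
by have [[]] := prP 0%N (leq0n _).
Qed.

End PrimeChains.

(** * Height bound from algebraically independent variables *)

Section ToricHeight.
Variables (k : fieldType) (n : nat) (M : matroid n).
Local Notation N := #|bases M|.

(** The monomials in the [d] chosen variables with exponents below [D] have distinct images, hence
    are independent modulo the ideal. There are [D ^ d] of them, of degree at most [D * d]. *)
Lemma toric_chain_bound h d (iota : 'I_d -> 'I_N) :
  injective iota ->
  (forall u v : 'X_{1.. N}, (forall j, j \notin codom iota -> u j = 0%N /\ v j = 0%N) ->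
     mon_image u = mon_image v -> u = v) ->
  prime_chain_to (@toric_ideal k n M) h -> (d + h <= N)%N.
Proof.
move=> iI inj ch; apply: (prime_chain_growth ch); exists d => D D0.
pose X := {ffun 'I_d -> 'I_D}.
pose U (x : X) : 'X_{1.. N} := [multinom (\sum_(i < d) (iota i == j) * x i)%N | j < N].
have Ui x i : U x (iota i) = x i.
  rewrite mnmE (bigD1 i) //= eqxx mul1n big1 ?addn0 // => l li.
  by rewrite (inj_eq iI) (negbTE li).
have Uc x j : j \notin codom iota -> U x j = 0%N.
  move=> jc; rewrite mnmE big1 // => i _; case: eqP => // E.
  by move: jc; rewrite -E codom_f.
have Uinj x y : mon_image (U x) = mon_image (U y) -> x = y.
  move=> E; have UE : U x = U y by apply: inj E => j jc; rewrite !Uc.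
  by apply/ffunP=> i; apply: val_inj; rewrite /= -!Ui UE.
exists X, (fun x => 'X_[U x]); split.
- by rewrite card_ffun !card_ord.
- move=> x; rewrite msizeX ltnS mdegE.
  under eq_bigr => j _ do rewrite mnmE.
  rewrite exchange_big /= mulnC -[X in (_ <= X * _)%N]card_ord -sum_nat_const.
  apply: leq_sum => i _; rewrite (bigD1 (iota i)) //= eqxx mul1n big1 ?addn0; first exact: ltnW.
  by move=> j /negbTE; rewrite eq_sym => ->.
- move=> a; rewrite /toric_ideal toric_map_sum.
  under eq_bigr => x _ do rewrite toric_mapZ toric_mapX.
  move=> E x; have := congr1 (mcoeff (mon_image (U x))) E.
  rewrite mcoeff0 raddf_sum /= (bigD1 x) //= big1 ?addr0.
    by rewrite mcoeffZ mcoeffX eqxx mulr1.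
  move=> y yx; rewrite mcoeffZ mcoeffX; case: eqP => [/Uinj e|]; last by rewrite mulr0.
  by rewrite e eqxx in yx.
Qed.

End ToricHeight.

(** * Gradients along the diagonal curve *)

Section SpannedIdeal.
Variables (R : comNzRingType) (gs : seq R).

Definition span_ideal (x : R) :=
  exists c : 'I_(size gs) -> R, x = \sum_(i < size gs) c i * gs`_i.

Lemma span_ideal_is_ideal : is_ideal span_ideal.
Proof.
split.
- by exists (fun _ => 0); rewrite big1 // => i _; rewrite mul0r.
- move=> a b [c ->] [d ->]; exists (fun i => c i + d i); rewrite -big_split /=.
  by apply: eq_bigr => i _; rewrite mulrDl.
- move=> r a [c ->]; exists (fun i => r * c i); rewrite big_distrr /=.
  by apply: eq_bigr => i _; rewrite mulrA.
Qed.

Lemma span_ideal_nth i : (i < size gs)%N -> span_ideal gs`_i.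
Proof.
move=> si; exists (fun j => (j == Ordinal si)%:R).
by rewrite (bigD1 (Ordinal si)) //= eqxx mul1r big1 ?addr0 // => j /negbTE ->; rewrite mul0r.
Qed.

End SpannedIdeal.

Lemma ideal_sum (R : comNzRingType) (J : R -> Prop) (X : eqType) (s : seq X) F :
  is_ideal J -> (forall x, x \in s -> J (F x)) -> J (\sum_(x <- s) F x).
Proof.
by case=> J0 JD _ JF; rewrite big_seq; elim/big_ind: _ => // x /JF.
Qed.

Section Gradients.
Variables (k : fieldType) (n r : nat) (M : matroid n).
Hypotheses (hr : has_rank M r) (r0 : (0 < r)%N).
Local Notation N := #|bases M|.
Local Notation I := (@toric_ideal k n M).
Local Notation K := {fraction {poly k}}.
Local Notation "p %:F" := (@FracField.tofrac {poly k} p).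

(* Restriction to the curve [t |-> (t^r, ..., t^r)], which lies on the toric variety. *)
Definition curve_eval (p : {mpoly k[N]}) : {poly k} :=
  mmap (@polyC k) (fun _ => 'X^r) p.

(** The factor [y_j] restricts to [t^r], so it only rescales the gradient by a nonzero power of [t];
    with it every monomial is an eigenvector of the operator. *)
Definition curve_euler (j : 'I_N) (p : {mpoly k[N]}) : {poly k} :=
  curve_eval ('X_j * p^`M(j)).

Lemma curve_evalD : {morph curve_eval : p q / p + q}.
Proof. exact: raddfD. Qed.
Lemma curve_evalB : {morph curve_eval : p q / p - q}.
Proof. exact: raddfB. Qed.
Lemma curve_evalM : {morph curve_eval : p q / p * q}.
Proof. exact: rmorphM. Qed.
Lemma curve_eval_sum (X : Type) (s : seq X) (P : pred X) F :
  curve_eval (\sum_(x <- s | P x) F x) = \sum_(x <- s | P x) curve_eval (F x).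
Proof. by rewrite /curve_eval raddf_sum. Qed.
Lemma curve_evalZ c p : curve_eval (c *: p) = c *: curve_eval p.
Proof. by rewrite /curve_eval mmapZ mul_polyC. Qed.

Lemma curve_evalX u : curve_eval 'X_[u] = 'X^(r * mdeg u).
Proof.
rewrite /curve_eval mmapX /mmap1 mdegE big_distrr /= (big_morph _ (exprD 'X) (expr0 _)).
by apply: eq_bigr => i _; rewrite exprM.
Qed.

(** Restriction to the curve factors through the toric map followed by sending every [x_i] to [t],
    since each basis has [r] elements. *)
Lemma curve_eval_toric p : I p -> curve_eval p = 0.
Proof.
move=> Ip; suff -> : curve_eval p = mmap (@polyC k) (fun _ => 'X) (toric_map p).
  by rewrite Ip mmap0.
rewrite {1 2}[p]mpolyE curve_eval_sum toric_map_sum raddf_sum /=.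
apply: eq_bigr => u _; rewrite curve_evalZ curve_evalX toric_mapZ toric_mapX.
rewrite mmapZ mmapX /mmap1 -mul_polyC; congr (_ * _).
by rewrite prodrXr -mdegE (mdeg_mon_image _ hr).
Qed.

(** The curve passes through the origin at [t = 0], because [r] is positive. *)
Lemma curve_eval_coef0 p : curve_eval p = 0 -> p@_0%MM = 0.
Proof.
move=> p0; have : (curve_eval p).[0] = 0 by rewrite p0 horner0.
rewrite {1}[p]mpolyE curve_eval_sum horner_sum => <-.
transitivity (\sum_(u <- msupp p) p@_u * ('X_[u] : {mpoly k[N]})@_0%MM).
  by rewrite {1}[p]mpolyE raddf_sum /=; apply: eq_bigr => u _; rewrite mcoeffZ.
apply: eq_bigr => u _; rewrite curve_evalZ curve_evalX hornerZ hornerXn mcoeffX.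
by rewrite expr0n muln_eq0 mdeg_eq0 (gtn_eqF r0).
Qed.

(** By the Leibniz rule; the term with the derivative of [c] dies because [g] vanishes on the
    curve. *)
Lemma curve_eulerM j c g :
  curve_eval g = 0 -> curve_euler j (c * g) = curve_eval c * curve_euler j g.
Proof.
move=> g0; rewrite /curve_euler.
have -> : 'X_j * (c * g)^`M(j) = ('X_j * c^`M(j)) * g + c * ('X_j * g^`M(j)).
  by rewrite mderivM mulrDr [c * ('X_j * _)]mulrCA; congr (_ + _); rewrite mulrA.
by rewrite curve_evalD (curve_evalM _ g) g0 mulr0 add0r curve_evalM.
Qed.

Lemma curve_euler_sum j (X : Type) (s : seq X) (P : pred X) F :
  curve_euler j (\sum_(x <- s | P x) F x) = \sum_(x <- s | P x) curve_euler j (F x).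
Proof. by rewrite /curve_euler raddf_sum /= mulr_sumr curve_eval_sum. Qed.

Lemma curve_eulerB j : {morph curve_euler j : p q / p - q}.
Proof. by move=> p q; rewrite /curve_euler mderivB mulrBr curve_evalB. Qed.
Lemma curve_eulerD j : {morph curve_euler j : p q / p + q}.
Proof. by move=> p q; rewrite /curve_euler mderivD mulrDr curve_evalD. Qed.

Lemma curve_eulerX j u : curve_euler j 'X_[u] = (u j)%:R *: 'X^(r * mdeg u).
Proof.
rewrite /curve_euler mderivX -scalerAr curve_evalZ.
case E: (u j) => [|m]; first by rewrite !scale0r.
rewrite -mpolyXD addmC submK ?curve_evalX //.
by apply/mnm_lepP => i; rewrite mnm1E; case: eqP => // <-; rewrite E.
Qed.

Lemma generators_in (gs : seq {mpoly k[N]}) i :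
  generated_by I gs -> (i < size gs)%N -> I gs`_i.
Proof. by move=> gen si; apply/gen/span_ideal_nth. Qed.

Definition grad_mx (gs : seq {mpoly k[N]}) : 'M[K]_(size gs, N) :=
  \matrix_(i, j) (curve_euler j gs`_i)%:F.

Definition diff_mx s (u v : 'I_s -> 'X_{1.. N}) : 'M[k]_(s, N) :=
  \matrix_(i, j) ((u i j)%:R - (v i j)%:R).

(** Along the curve the gradient of a binomial is a power of [t] times its exponent difference, and
    writing the binomial in the generators makes it a combination of their gradients. Scaling rows
    by nonzero powers of [t] keeps the rank [s]. *)
Lemma grad_mx_rank (gs : seq {mpoly k[N]}) s (u v : 'I_s -> 'X_{1.. N}) :
  generated_by I gs -> (forall i, mon_image (u i) = mon_image (v i)) ->
  row_free (diff_mx u v) -> (s <= \rank (grad_mx gs))%N.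
Proof.
move=> gen E fD.
have /fin_all_exists [c Ec] : forall i, exists c : 'I_(size gs) -> {mpoly k[N]},
    'X_[u i] - 'X_[v i] = \sum_(l < size gs) c l * gs`_l.
  by move=> i; apply/gen/toric_idealX.
have Ed i : mdeg (u i) = mdeg (v i).
  have /eqP := congr1 (@mdeg n) (E i).
  by rewrite !(mdeg_mon_image _ hr) eqn_pmul2l // => /eqP.
pose f : {rmorphism k -> K} := (@FracField.tofrac {poly k} \o polyC).
pose T : 'rV[K]_s := \row_i ('X^(r * mdeg (u i)))%:F.
pose C : 'M[K]_(s, size gs) := \matrix_(i, l) (curve_eval (c i l))%:F.
have EM : diag_mx T *m map_mx f (diff_mx u v) = C *m grad_mx gs.
  apply/matrixP=> i j; rewrite mul_diag_mx !mxE.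
  have <- : (curve_euler j ('X_[u i] - 'X_[v i]))%:F =
      ('X^(r * mdeg (u i)))%:F * f ((u i j)%:R - (v i j)%:R).
    by rewrite curve_eulerB !curve_eulerX -Ed -scalerBl -mul_polyC mulrC rmorphM.
  rewrite Ec curve_euler_sum rmorph_sum /=; apply: eq_bigr => l _.
  by rewrite !mxE curve_eulerM ?rmorphM //; apply/curve_eval_toric/generators_in.
have fD' : row_free (map_mx f (diff_mx u v)) by rewrite /row_free mxrank_map.
have <- : \rank (diag_mx T) = s.
  apply: mxrank_unit; rewrite unitmxE det_diag unitfE; apply/prodf_neq0 => i _.
  by rewrite mxE tofrac_eq0 expf_neq0 // polyX_eq0.
by rewrite -(mxrankMfree _ fD') EM mxrankM_maxr.
Qed.

Lemma generators_size_ge (gs : seq {mpoly k[N]}) s (u v : 'I_s -> 'X_{1.. N}) :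
  generated_by I gs -> (forall i, mon_image (u i) = mon_image (v i)) ->
  row_free (diff_mx u v) -> (s <= size gs)%N.
Proof.
by move=> gen E fD; apply: leq_trans (grad_mx_rank gen E fD) (rank_leq_row _).
Qed.

(* With as few generators as the rank of their gradients along the curve, an element of the
   ideal with zero gradient along the curve has coefficients vanishing on the curve, hence
   lies in the product of the irrelevant ideal with I. *)
Lemma flat_quadric_eq0 (gs : seq {mpoly k[N]}) s (u v : 'I_s -> 'X_{1.. N}) q m :
  generated_by I gs -> (forall i, mon_image (u i) = mon_image (v i)) ->
  row_free (diff_mx u v) -> (size gs <= s)%N ->
  I q -> (forall j, curve_euler j q = 0) -> (mdeg m <= 2)%N -> q@_m = 0.
Proof.
move=> gen E fD le /gen [c ->] Dq m2.
have fG : row_free (grad_mx gs).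
  by rewrite /row_free eqn_leq rank_leq_row (leq_trans le) // (grad_mx_rank gen E fD).
pose w : 'rV[K]_(size gs) := \row_l (curve_eval (c l))%:F.
have w0 : w = 0.
  apply: (row_free_inj fG); rewrite mul0mx; apply/rowP=> j; rewrite !mxE.
  transitivity ((curve_euler j (\sum_(i < size gs) c i * gs`_i))%:F : K); last first.
    by rewrite Dq tofrac0.
  rewrite curve_euler_sum rmorph_sum /=; apply: eq_bigr => l _.
  by rewrite !mxE curve_eulerM ?rmorphM //; apply/curve_eval_toric/generators_in.
have c0 l : (c l)@_0%MM = 0.
  apply: curve_eval_coef0; apply/eqP; rewrite -tofrac_eq0.
  by have /rowP/(_ l) := w0; rewrite !mxE => ->.
rewrite raddf_sum /= big1 // => l _; rewrite mcoeffM big1 // => -[a b] /= /eqP Em.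
have [/eqP a0|a0] := boolP (mdeg a == 0%N).
  by move/eqP: a0; rewrite mdeg_eq0 => /eqP /= ->; rewrite c0 mul0r.
have gl := generators_in gen (ltn_ord l).
rewrite (toric_ideal_coeff_deg1 hr r0 gl) ?mulr0 //.
have : (mdeg m = mdeg a + mdeg b :> nat)%N by rewrite -mdegD; congr mdeg.
by move: a0 m2; rewrite /=; lia.
Qed.

End Gradients.

Lemma natr_gcdn_eq0 (R : pzRingType) a b :
  a%:R = 0 :> R -> b%:R = 0 :> R -> (gcdn a b)%:R = 0 :> R.
Proof.
move=> a0 b0; case: (posnP a) => [->|apos]; first by rewrite gcd0n.
have [u v E _] := egcdnP b apos; have := congr1 (fun m => m%:R : R) E.
by rewrite natrD !natrM a0 b0 !mulr0 add0r => <-.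
Qed.

(** * Quadrics with zero gradient in a complete intersection *)

Section FlatQuadrics.
Variables (k : fieldType) (n r : nat) (M : matroid n).
Hypotheses (hr : has_rank M r) (r0 : (0 < r)%N).
Local Notation N := #|bases M|.
Local Notation I := (@toric_ideal k n M).
Local Notation mon := 'X_{1.. N}.

Definition diff_row (u v : mon) : 'rV[k]_N := \row_j ((u j)%:R - (v j)%:R).

Definition independent_binomials s (u v : 'I_s -> mon) :=
  (forall i, mon_image (u i) = mon_image (v i)) /\ row_free (diff_mx k u v).

(** Independent families have at most [N] members, so a largest one exists; a difference outside its
    row space could be prepended to it. *)
Lemma max_independent_binomials : exists s (u v : 'I_s -> mon),
  independent_binomials u v /\
  forall a b, mon_image a = mon_image b -> (diff_row a b <= diff_mx k u v)%MS.
Proof.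
pose good s := exists u v : 'I_s -> mon, independent_binomials u v.
have [s [[u [v uv]] ngood]] : exists s, good s /\ ~ good s.+1.
  apply: NNPP => none; have all s : good s.
    elim: s => [|s IH]; last by apply: NNPP => H; apply: none; exists s.
    exists (fun _ => 0%MM), (fun _ => 0%MM); split => //.
    by rewrite /row_free -leqn0 rank_leq_row.
  have [u [v [_ /eqP fD]]] := all N.+1.
  by have := rank_leq_col (diff_mx k u v); rewrite fD ltnn.
exists s, u, v; split => // a b ab; have [E fD] := uv.
case: (boolP (_ <= _)%MS) => // nle; case: ngood.
pose cons_mon (m : mon) (w : 'I_s -> mon) (i : 'I_(1 + s)) :=
  match split i with inl _ => m | inr j => w j end.
exists (cons_mon a u), (cons_mon b v); split.
  by move=> i; rewrite /cons_mon; case: split.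
have -> : diff_mx k (cons_mon a u) (cons_mon b v) =
    col_mx (diff_row a b) (diff_mx k u v) :> 'M_(1 + s, N).
  by apply/matrixP=> i j; rewrite !mxE /cons_mon; case: split => l; rewrite !mxE.
rewrite /row_free eqn_leq rank_leq_row /=.
have lt : (diff_mx k u v < diff_row a b + diff_mx k u v)%MS.
  by rewrite ltmxE addsmxSr addsmx_sub (negbTE nle).
by have := rank_ltmx lt; rewrite (eqP fD) addsmxE.
Qed.

(* A nonzero relation supported off the pivot columns, divided by the gcd of its entries,
   would have nonzero image in k^N, whatever the characteristic. *)
Lemma nonpivot_independent s (u v : 'I_s -> mon) (f : 'I_s -> 'I_N) (a b : mon) :
  (forall a b, mon_image a = mon_image b -> (diff_row a b <= diff_mx k u v)%MS) ->
  row_free (colsub f (diff_mx k u v)) ->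
  (forall i, a (f i) = 0%N /\ b (f i) = 0%N) -> mon_image a = mon_image b -> a = b.
Proof.
(* Subtraction is truncated, so one of the two summands is always zero and [x j] is the absolute
   difference of [a j] and [b j]. *)
move=> span free ab0 ab; apply/eqP; apply: contraT => nab.
pose x j := (a j - b j + (b j - a j))%N; pose g := \big[gcdn/0%N]_j x j.
have gx j : (g %| x j)%N by apply: (biggcdn_inf j).
have [gxa gxb] : (forall j, g %| a j - b j)%N /\ (forall j, g %| b j - a j)%N.
  split=> j; have := gx j; rewrite /x; case/orP: (leq_total (a j) (b j));
    by rewrite -subn_eq0 => /eqP ->; rewrite ?addn0 ?add0n ?dvdn0.
have [j0 xj0] : exists j, (0 < x j)%N.
  apply/existsP; apply: contraR nab => /existsPn x0; apply/eqP/mnmP => j.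
  by have := x0 j; rewrite /x; lia.
have g0 : (0 < g)%N by apply: dvdn_gt0 (gx j0).
pose a' : mon := [multinom ((a j - b j) %/ g)%N | j < N].
pose b' : mon := [multinom ((b j - a j) %/ g)%N | j < N].
have ab' : mon_image a' = mon_image b'.
  (* After multiplying by [g] and adding the image of [b], both sides become the image of the
     pointwise maximum of [a] and [b]. *)
  apply/mnmP=> i; apply/eqP; rewrite -(eqn_pmul2l g0) -(eqn_add2r (mon_image b i)).
  rewrite -{2}ab !mon_imageE !big_distrr -!big_split /=; apply/eqP/eq_bigr => j _.
  rewrite ![(g * (_ * _))%N]mulnCA -!mulnDr; congr (_ * _)%N.
  by rewrite !mnmE ![(g * _)%N]mulnC !divnK // ![(_ - _ + _)%N]addnC -!maxnE maxnC.
(* The difference lies in the row space and vanishes on the pivot columns, where the rows are still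
   independent. *)
have d0 : diff_row a' b' = 0.
  have /submxP [c Ec] := span _ _ ab'.
  suff c0 : c = 0 by rewrite Ec c0 mul0mx.
  apply: (row_free_inj free); rewrite mul0mx /= mulmx_colsub -Ec.
  apply/rowP=> i; rewrite !mxE !mnmE; have [-> ->] := ab0 i.
  by rewrite subn0 div0n subrr.
have w0 j : (x j %/ g)%:R = 0 :> k.
  have := congr1 (fun w : 'rV_N => w 0 j) d0; rewrite !mxE !mnmE divnDl // natrD.
  case/orP: (leq_total (a j) (b j)); rewrite -subn_eq0 => /eqP ->;
    by rewrite div0n ?subr0 ?sub0r ?addr0 ?add0r // => /eqP; rewrite ?oppr_eq0 => /eqP.
(* The divided entries have gcd 1, yet by Bezout their gcd vanishes in [k]. *)
have : (\big[gcdn/0]_j (x j %/ g))%N%:R = 0 :> k.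
  by elim/big_ind: _ => // p q; apply: natr_gcdn_eq0.
suff -> : (\big[gcdn/0]_j (x j %/ g) = 1)%N by move/eqP; rewrite oner_eq0.
set h := \big[_/_]_j _; apply/eqP; rewrite -dvdn1 -(dvdn_pmul2r g0) mul1n.
apply/dvdn_biggcdP=> j _; rewrite -(divnK (gx j)) dvdn_pmul2r //.
exact: (biggcdn_inf j).
Qed.

(** The variables off the pivot columns are algebraically independent modulo the ideal, so the
    height is at most [s]. A complete intersection then has at most [s] generators, as
    [flat_quadric_eq0] requires. *)
Lemma ci_flat_quadric_eq0 q m : complete_intersection I ->
  I q -> (forall j, curve_euler r j q = 0) -> (mdeg m <= 2)%N -> q@_m = 0.
Proof.
case=> _ [h [[ch _] [[gs sgs gen] _]]] Iq Dq m2.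
have [s [u [v [[E fD] span]]]] := max_independent_binomials.
have fT : row_full (diff_mx k u v)^T by rewrite /row_full mxrank_tr.
pose f := fullrankfun fT; pose J := ~: [set f i | i in 'I_s].
have fpiv : row_free (colsub f (diff_mx k u v)).
  rewrite /row_free -mxrank_tr -[X in _ == X](mxrank_fullrowsub fT).
  by apply/eqP; congr mxrank; apply/matrixP=> i j; rewrite !mxE.
have cJ : (#|J| + s = N)%N.
  rewrite -[X in (_ + X)%N](card_ord s) -(card_imset _ (@fullrankfun_inj _ _ _ _ fT)) addnC.
  by rewrite cardsC card_ord.
have le : (#|J| + h <= N)%N.
  apply: (toric_chain_bound (@enum_val_inj _ (mem J)) _ ch) => a b ab0.
  apply: nonpivot_independent span fpiv _ => i; apply: ab0.
  apply/negP => /codomP [l El]; have := enum_valP l; rewrite -El inE.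
  by rewrite imset_f.
by apply: (flat_quadric_eq0 hr r0 gen E fD _ Iq Dq m2); rewrite sgs -(leq_add2l #|J|) cJ.
Qed.

End FlatQuadrics.

(* Six bases forming a [2 x 3] grid whose [2 x 2] minors lie in the toric ideal. *)
Definition segre_grid n (M : matroid n) := exists x1 x2 x3 y1 y2 y3 : {set 'I_n},
  [/\ uniq [:: x1; x2; x3; y1; y2; y3],
      {subset [:: x1; x2; x3; y1; y2; y3] <= bases M},
      forall i, ((i \in x1) + (i \in y2) = (i \in x2) + (i \in y1))%N &
      forall i, ((i \in x2) + (i \in y3) = (i \in x3) + (i \in y2))%N].

Lemma mnm_pair_neq N (a b c d : 'I_N) :
  (a != c) && (a != d) -> ((U_(c) + U_(d))%MM == (U_(a) + U_(b))%MM) = false.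
Proof.
case/andP=> ac ad; apply/negP => /eqP/mnmP/(_ a); rewrite !mnmDE !mnm1E eqxx.
by rewrite ![_ == a]eq_sym (negbTE ac) (negbTE ad).
Qed.

(* The alternating sum of the three [2 x 2] minors of the grid has zero gradient along the
   diagonal curve. *)
Lemma segre_grid_not_ci (k : fieldType) n r (M : matroid n) :
  has_rank M r -> (0 < r)%N -> segre_grid M ->
  ~ complete_intersection (@toric_ideal k n M).
Proof.
move=> hr r0 [x1 [x2 [x3 [y1 [y2 [y3 [un sub E1 E2]]]]]]] ci.
have x1M : x1 \in bases M by apply: sub; rewrite !inE eqxx.
pose idx B := enum_rank_in x1M B.
have idxK B : B \in [:: x1; x2; x3; y1; y2; y3] -> enum_val (idx B) = B.
  by move=> /sub BM; rewrite enum_rankK_in.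
have idx_neq B C : B \in [:: x1; x2; x3; y1; y2; y3] ->
    C \in [:: x1; x2; x3; y1; y2; y3] -> B != C -> idx B != idx C.
  by move=> Bs Cs; apply: contraNneq => E; rewrite -(idxK B) // E idxK.
have [? ? ?] : [/\ x1 \in [:: x1; x2; x3; y1; y2; y3], x2 \in [:: x1; x2; x3; y1; y2; y3]
    & x3 \in [:: x1; x2; x3; y1; y2; y3]] by rewrite !inE !eqxx !orbT.
have [? ? ?] : [/\ y1 \in [:: x1; x2; x3; y1; y2; y3], y2 \in [:: x1; x2; x3; y1; y2; y3]
    & y3 \in [:: x1; x2; x3; y1; y2; y3]] by rewrite !inE !eqxx !orbT.
pose P B C : 'X_{1.. #|bases M|} := (U_(idx B) + U_(idx C))%MM.
have dP B C : mdeg (P B C) = 2%N by rewrite mdegD !mdeg1.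
pose q : {mpoly k[#|bases M|]} := 'X_[P x1 y2] - 'X_[P x2 y1]
  + ('X_[P x2 y3] - 'X_[P x3 y2]) - ('X_[P x1 y3] - 'X_[P x3 y1]).
have Iq : @toric_ideal k n M q.
  have im B C B' C' : B \in [:: x1; x2; x3; y1; y2; y3] ->
      C \in [:: x1; x2; x3; y1; y2; y3] -> B' \in [:: x1; x2; x3; y1; y2; y3] ->
      C' \in [:: x1; x2; x3; y1; y2; y3] ->
      (forall i, ((i \in B) + (i \in C) = (i \in B') + (i \in C'))%N) ->
      mon_image (P B C) = mon_image (P B' C').
    move=> *; apply/mnmP=> i.
    by rewrite !mon_imageD !mnmDE !mon_imageU !idxK.
  rewrite /toric_ideal !(toric_mapB, toric_mapD, toric_mapX).
  rewrite (im x1 y2 x2 y1) // (im x2 y3 x3 y2) // (im x1 y3 x3 y1) ?subrr ?addr0 ?subr0 //.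
  by move=> i; move: (E1 i) (E2 i); do 6?case: (i \in _).
have Dq j : curve_euler r j q = 0.
  rewrite /q !(curve_eulerB, curve_eulerD, curve_eulerX) !dP -!scalerBl -!scalerDl -scalerBl.
  rewrite !mnmDE !natrD [X in X *: _](_ : _ = 0) ?scale0r //.
  move: (U_(idx x1)%MM j)%:R (U_(idx x2)%MM j)%:R (U_(idx x3)%MM j)%:R => a1 a2 a3.
  by move: (U_(idx y1)%MM j)%:R (U_(idx y2)%MM j)%:R (U_(idx y3)%MM j)%:R => b1 b2 b3; ring.
(* The coefficient of [P x1 y2] in [q] is 1: [x1] separates this monomial from the others, except
   from [P x1 y3], where [y2] does. *)
have := ci_flat_quadric_eq0 hr r0 ci Iq Dq (eq_leq (dP x1 y2)).
rewrite /q !(mcoeffB, mcoeffD, mcoeffX) eqxx.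
case/and5P: un => + _ _ _ /andP[+ _]; rewrite !inE !negb_or.
case/and5P=> x12 x13 x1y1 x1y2 x1y3 y23.
have -> : (P x1 y3 == P x1 y2) = false.
  rewrite /P addmC [X in _ == X]addmC; apply: mnm_pair_neq.
  by rewrite !idx_neq // eq_sym.
rewrite !mnm_pair_neq ?idx_neq //.
by rewrite !subr0 addr0 => /eqP; rewrite oner_eq0.
Qed.

(** * Grids of bases *)

(** Non-adjacency is transitive and there is an edge, so the graph is complete multipartite without
    isolated points. The last two hypotheses exclude a star, and what remains contains a complete
    bipartite graph on one of the ten splits of five points into two and three. *)
Lemma five_point_graph (b : nat -> nat -> bool) :
  (forall i j l, (i < j < l)%N && (l < 5)%N ->
     [&& b i j ==> b i l || b j l, b i l ==> b i j || b j l & b j l ==> b i j || b i l]) ->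
  b 0%N 1%N -> [|| b 0%N 2%N, b 0%N 3%N | b 0%N 4%N] -> [|| b 1%N 2%N, b 1%N 3%N | b 1%N 4%N] ->
  [|| [|| [&& b 0 2, b 0 3, b 0 4, b 1 2, b 1 3 & b 1 4],
      [&& b 0 1, b 0 3, b 0 4, b 1 2, b 2 3 & b 2 4],
      [&& b 0 1, b 0 2, b 0 4, b 1 3, b 2 3 & b 3 4],
      [&& b 0 1, b 0 2, b 0 3, b 1 4, b 2 4 & b 3 4] |
      [&& b 0 1, b 1 3, b 1 4, b 0 2, b 2 3 & b 2 4]],
      [&& b 0 1, b 1 2, b 1 4, b 0 3, b 2 3 & b 3 4],
      [&& b 0 1, b 1 2, b 1 3, b 0 4, b 2 4 & b 3 4],
      [&& b 0 2, b 1 2, b 2 4, b 0 3, b 1 3 & b 3 4],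
      [&& b 0 2, b 1 2, b 2 3, b 0 4, b 1 4 & b 3 4] |
      [&& b 0 3, b 1 3, b 2 3, b 0 4, b 1 4 & b 2 4]]%N.
Proof.
move=> H; move: (H 0 1 2 isT)%N (H 0 1 3 isT)%N (H 0 1 4 isT)%N (H 0 2 3 isT)%N (H 0 2 4 isT)%N
  (H 0 3 4 isT)%N (H 1 2 3 isT)%N (H 1 2 4 isT)%N (H 1 3 4 isT)%N (H 2 3 4 isT)%N.
case: (b 0 1)%N => //; case: (b 0 2)%N => //=; case: (b 1 2)%N => //=;
case: (b 0 3)%N => //=; case: (b 1 3)%N => //=; case: (b 2 3)%N => //=;
case: (b 0 4)%N => //=; case: (b 1 4)%N => //=; case: (b 2 4)%N => //=;
by case: (b 3 4)%N.
Qed.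

Section FivePointMinor.
Variables (n : nat) (M : matroid n) (e : bool) (V : seq 'I_n) (C : {set 'I_n}).
Hypotheses (uV : uniq V) (sV : size V = 5%N).

(* [C] extended by the pair [u, v] of the five points of [V] when [e = false], and by the
   complementary triple when [e = true]. *)
Definition pair_set (u v : 'I_n) :=
  [set i | if i \in V then e (+) (i \in [:: u; v]) else i \in C].

Lemma pair_setC u v : pair_set u v = pair_set v u.
Proof. by apply/setP=> i; rewrite !inE orbC. Qed.

(** Parallelism is transitive in a rank-two minor, and dually for triples; the basis at [v], [z]
    says that [v] is not a loop there. A single exchange suffices: [z] is replaced by [u] or [w]
    among pairs, and [v] by [u] or [w] among triples. *)
Lemma pair_set_exchange u w v z :
  u \in V -> w \in V -> v \in V -> z \in V -> v != u -> v != w -> u != w -> z != v ->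
  pair_set u w \in bases M -> pair_set v z \in bases M ->
  (pair_set v u \in bases M) || (pair_set v w \in bases M).
Proof.
move=> uV' wV vV zV vu vw uw zv b1 b2.
have [zu|zu] := eqVneq z u; first by rewrite -zu b2.
have [zw|zw] := eqVneq z w; first by rewrite -zw b2 orbT.
have in1 : v \in pair_set u w :\: pair_set v z = e.
  by rewrite !inE vV eqxx (negbTE vu) (negbTE vw) /=; case: e.
have in2 : z \in pair_set v z :\: pair_set u w = ~~ e.
  by rewrite !inE zV eqxx (negbTE zu) (negbTE zw) orbT /=; case: e.
(* Off [V] all these sets agree with [C], so only the five points need to be compared. *)
have eqV y a : y \in V -> a \in V ->
    (forall i, i \in V -> e (+) ((i == v) || (i == y)) =
       (if e then (i != v) && ~~ ((i == u) || (i == w)) || (i == a)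
        else (i != z) && ((i == v) || (i == z)) || (i == a))) ->
    pair_set v y = if e then (pair_set u w :\ v) :|: [set a]
                   else (pair_set v z :\ z) :|: [set a].
  move=> yV aV H; case E: e H => H; apply/setP=> i; rewrite !inE E;
    have [iV|iV] := boolP (i \in V); rewrite ?H ?addTb ?addFb //;
    have niV a' : a' \in V -> (i == a') = false by move=> a'V; apply: contraNF iV => /eqP ->.
  - by rewrite !niV ?orbF.
  - by rewrite !niV ?orbF.
case E: e in1 in2 eqV => in1 in2 eqV.
- have [y] := bases_exchange b1 b2 in1; rewrite !inE E.
  case: (boolP (y \in V)) => [yV|_ /andP[/negP nC /nC//]].
  rewrite !addTb negbK => /andP[/orP[]/eqP -> _] b.
  + apply/orP; right; rewrite (eqV w u) // => i iV /=.
    have [->|iu] := eqVneq i u; first by rewrite eq_sym (negbTE vu) (negbTE uw) orbT.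
    by rewrite orbF /= negb_or.
  + apply/orP; left; rewrite (eqV u w) // => i iV /=.
    have [->|iu] := eqVneq i w; first by rewrite eq_sym (negbTE vw) eq_sym (negbTE uw) orbT.
    by rewrite !orbF /= negb_or.
- have [y] := bases_exchange b2 b1 in2; rewrite !inE E.
  case: (boolP (y \in V)) => [yV|_ /andP[/negP nC /nC//]].
  rewrite !addFb => /andP[_ /orP[] /eqP ->] b.
  + apply/orP; left; rewrite (eqV u u) // => i iV /=.
    by have [->|] := eqVneq i z; rewrite ?(negbTE zv) ?(negbTE zu) ?orbF.
  + apply/orP; right; rewrite (eqV w w) // => i iV /=.
    by have [->|] := eqVneq i z; rewrite ?(negbTE zv) ?(negbTE zw) ?orbF.
Qed.

Lemma pair_set_neq a b c d : a \in V -> a != c -> a != d -> pair_set a b != pair_set c d.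
Proof.
move=> aV ac ad; apply/eqP => /setP/(_ a); rewrite !inE aV eqxx (negbTE ac) (negbTE ad).
by case: e.
Qed.

Lemma pair_set_sum u u' w x i : u \in V -> u' \in V -> w \in V -> x \in V ->
  u != w -> u != x -> u' != w -> u' != x -> u != u' -> w != x ->
  ((i \in pair_set u w) + (i \in pair_set u' x) =
   (i \in pair_set u x) + (i \in pair_set u' w))%N.
Proof.
move=> uV' u'V wV xV uw ux u'w u'x uu' wx; rewrite !inE; case: (i \in V) => //.
have [->|_] := eqVneq i u; first by rewrite (negbTE uw) (negbTE ux) (negbTE uu') addnC.
have [->|_] := eqVneq i u'; first by rewrite (negbTE u'w) (negbTE u'x) addnC.
by rewrite addnC.
Qed.

(** A complete bipartite graph of bases with sides [i], [j] and [a], [b], [c] is itself the grid,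
    its sides indexing rows and columns. *)
Lemma pair_set_grid x0 i j a b c (v := nth x0 V) :
  all (fun l => (l < 5)%N) [:: i; j; a; b; c] -> uniq [:: i; j; a; b; c] ->
  [&& pair_set (v i) (v a) \in bases M, pair_set (v i) (v b) \in bases M,
      pair_set (v i) (v c) \in bases M, pair_set (v j) (v a) \in bases M,
      pair_set (v j) (v b) \in bases M & pair_set (v j) (v c) \in bases M] ->
  segre_grid M.
Proof.
move=> lt5 un /and5P[b1 b2 b3 b4 /andP[b5 b6]].
have inV l : l \in [:: i; j; a; b; c] -> v l \in V.
  by move=> /(allP lt5) ?; rewrite mem_nth ?sV.
have neq l m : l \in [:: i; j; a; b; c] -> m \in [:: i; j; a; b; c] -> l != m -> v l != v m.
  by move=> /(allP lt5) ? /(allP lt5) ? ?; rewrite nth_uniq ?sV.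
have [iI jI aI bI cI] : [/\ i \in [:: i; j; a; b; c], j \in [:: i; j; a; b; c],
    a \in [:: i; j; a; b; c], b \in [:: i; j; a; b; c] & c \in [:: i; j; a; b; c]].
  by rewrite !inE !eqxx !orbT.
move: un; rewrite /= !inE !negb_or -!andbA => /and5P[ij ia ib ic /and5P[ja jb jc ab /and3P[ac bc _]]].
exists (pair_set (v i) (v a)), (pair_set (v i) (v b)), (pair_set (v i) (v c)),
  (pair_set (v j) (v a)), (pair_set (v j) (v b)), (pair_set (v j) (v c)); split.
- have row l m m' : l \in [:: i; j; a; b; c] -> m \in [:: i; j; a; b; c] ->
      m' \in [:: i; j; a; b; c] -> m != l -> m != m' ->
      pair_set (v l) (v m) != pair_set (v l) (v m').
    by move=> lI mI m'I ml mm'; rewrite pair_setC pair_set_neq ?inV ?neq.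
  have col m m' : m \in [:: i; j; a; b; c] -> m' \in [:: i; j; a; b; c] -> i != m' ->
      pair_set (v i) (v m) != pair_set (v j) (v m').
    by move=> mI m'I im'; rewrite pair_set_neq ?inV ?neq.
  rewrite /= !inE !negb_or (row i a b) ?(row i a c) ?(row i b c) ?(row j a b) ?(row j a c)
    ?(row j b c) ?(col a a) ?(col a b) ?(col a c) ?(col b a) ?(col b b) ?(col b c)
    ?(col c a) ?(col c b) ?(col c c) //; by rewrite eq_sym.
- by move=> B; rewrite !inE => /or4P[|||/or3P[]] /eqP ->.
- by move=> l; apply: pair_set_sum; rewrite ?inV ?neq.
- by move=> l; apply: pair_set_sum; rewrite ?inV ?neq.
Qed.

(** The pairs that are bases form a graph on [V] to which [five_point_graph] applies. The covering
    of the [t]'s rules out isolated points, which is what the exchange lemma asks for. *)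
Lemma five_point_grid s1 s2 t1 t2 t3 : V = [:: s1; s2; t1; t2; t3] ->
  pair_set s1 s2 \in bases M ->
  (forall t, t \in [:: t1; t2; t3] ->
     (pair_set s1 t \in bases M) || (pair_set s2 t \in bases M)) ->
  [|| pair_set s1 t1 \in bases M, pair_set s1 t2 \in bases M | pair_set s1 t3 \in bases M] ->
  [|| pair_set s2 t1 \in bases M, pair_set s2 t2 \in bases M | pair_set s2 t3 \in bases M] ->
  segre_grid M.
Proof.
move=> EV b12 Ht H1 H2; pose v := nth s1 V.
pose b i j := pair_set (v i) (v j) \in bases M.
have bC i j : b i j = b j i by rewrite /b pair_setC.
have neq l m : (l < 5)%N -> (m < 5)%N -> l != m -> v l != v m.
  by move=> ? ? ?; rewrite nth_uniq ?sV.
have nonisolated l : (l < 5)%N -> exists2 m, (m < 5)%N && (m != l) & b l m.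
  case: l => [|[|[|[|[|//]]]]] _.
  - by exists 1%N; rewrite // /b /v EV.
  - by exists 0%N; rewrite // bC /b /v EV.
  - by case/orP: (Ht t1 (mem_head _ _)) => h; [exists 0%N|exists 1%N]; rewrite // bC /b /v EV.
  - have /Ht/orP[h|h] : t2 \in [:: t1; t2; t3] by rewrite !inE eqxx orbT.
      by exists 0%N; rewrite // bC /b /v EV.
    by exists 1%N; rewrite // bC /b /v EV.
  - have /Ht/orP[h|h] : t3 \in [:: t1; t2; t3] by rewrite !inE eqxx !orbT.
      by exists 0%N; rewrite // bC /b /v EV.
    by exists 1%N; rewrite // bC /b /v EV.
have ex i j l : (i < 5)%N -> (j < 5)%N -> (l < 5)%N -> l != i -> l != j -> i != j ->
    b i j -> b l i || b l j.
  move=> i5 j5 l5 li lj ij bij; have [m /andP[m5 ml] blm] := nonisolated l l5.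
  by apply: (@pair_set_exchange (v i) (v j) (v l) (v m)); rewrite ?mem_nth ?sV ?neq.
have b02 : b 0%N 1%N by rewrite /b /v EV.
have triple i j l : (i < j < l)%N && (l < 5)%N ->
    [&& b i j ==> b i l || b j l, b i l ==> b i j || b j l & b j l ==> b i j || b i l].
  case/andP=> /andP[ij jl] l5; apply/and3P; split; apply/implyP => h.
  - by rewrite (bC i) (bC j); apply: ex h; clear -ij jl l5; lia.
  - by rewrite (bC i); apply: ex h; clear -ij jl l5; lia.
  - by apply: ex h; clear -ij jl l5; lia.
have K i j x y z : all (fun l => (l < 5)%N) [:: i; j; x; y; z] -> uniq [:: i; j; x; y; z] ->
    [&& b i x, b i y, b i z, b j x, b j y & b j z] -> segre_grid M by exact: pair_set_grid.
have h1 : [|| b 0 2, b 0 3 | b 0 4]%N by rewrite /b /v EV.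
have h2 : [|| b 1 2, b 1 3 | b 1 4]%N by rewrite /b /v EV.
case/orP: (five_point_graph triple b02 h1 h2).
  case/or4P => [h|h|h|/orP[h|h]].
  - exact: K h.
  - by apply: (K 0 2 1 3 4)%N => //; rewrite (bC 2 1)%N.
  - by apply: (K 0 3 1 2 4)%N => //; rewrite (bC 3 1)%N (bC 3 2)%N.
  - by apply: (K 0 4 1 2 3)%N => //; rewrite !(bC 4)%N.
  - by apply: (K 1 2 0 3 4)%N => //; rewrite (bC 1 0)%N (bC 2 0)%N.
case/or4P => [h|h|h|/orP[h|h]].
- by apply: (K 1 3 0 2 4)%N => //; rewrite (bC 1 0)%N (bC 3 0)%N (bC 3 2)%N.
- by apply: (K 1 4 0 2 3)%N => //; rewrite (bC 1 0)%N !(bC 4)%N.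
- by apply: (K 2 3 0 1 4)%N => //; rewrite (bC 2 0)%N (bC 2 1)%N (bC 3 0)%N (bC 3 1)%N.
- by apply: (K 2 4 0 1 3)%N => //; rewrite (bC 2 0)%N (bC 2 1)%N !(bC 4)%N.
- by apply: (K 3 4 0 1 2)%N => //; rewrite !(bC 3)%N !(bC 4)%N.
Qed.
End FivePointMinor.

(** * Patterns in bipartite graphs without isolated vertices *)

Section Star.
Variables (T : finType).
Implicit Types (p q : {set T}) (adj : rel T).

(** The hypotheses of [five_point_grid] in terms of the fundamental graph of a basis; the edge
    joining [s1] and [s2] there corresponds to the basis itself. *)
Definition star23 p q adj := exists s1 s2 t1 t2 t3,
  [/\ [&& s1 \in p, s2 \in p & s1 != s2],
      [&& t1 \in q, t2 \in q, t3 \in q & uniq [:: t1; t2; t3]],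
      {in [:: t1; t2; t3], forall t, adj s1 t || adj s2 t},
      [|| adj s1 t1, adj s1 t2 | adj s1 t3] & [|| adj s2 t1, adj s2 t2 | adj s2 t3]].

Definition transp adj : rel T := fun x y => adj y x.

Lemma star23I p q adj s1 s2 t1 t2 t3 : s1 \in p -> s2 \in p -> s1 != s2 ->
  t1 \in q -> t2 \in q -> t3 \in q -> t1 != t2 -> t1 != t3 -> t2 != t3 ->
  adj s1 t1 -> adj s1 t2 -> adj s1 t3 || adj s2 t3 ->
  [|| adj s2 t1, adj s2 t2 | adj s2 t3] -> star23 p q adj.
Proof.
move=> s1p s2p s12 t1q t2q t3q t12 t13 t23 a11 a12 a3 a2.
exists s1, s2, t1, t2, t3; split=> //.
- by rewrite s1p s2p.
- by rewrite t1q t2q t3q /= !inE negb_or t12 t13 t23.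
- by move=> t; rewrite !inE => /or3P[] /eqP ->; rewrite ?a11 ?a12.
- by rewrite a11.
Qed.

(** If a vertex of [p] other than [v] sees some [s] besides [x] and [y], the three columns are [x],
    [y], [s]. Otherwise all those vertices see only [x] or [y]: a third vertex of [p] gives the
    transposed pattern centred at [x] and [y], and a third vertex of [q] is seen by [v] alone. *)
Lemma star23_degree2 p q adj v x y :
  {in p, forall s, exists2 t, t \in q & adj s t} ->
  {in q, forall t, exists2 s, s \in p & adj s t} ->
  (1 < #|p|)%N -> (2 < #|p|)%N || (2 < #|q|)%N ->
  v \in p -> x \in q -> y \in q -> x != y -> adj v x -> adj v y ->
  star23 p q adj \/ star23 q p (transp adj).
Proof.
move=> Hp Hq p2 pq3 vp xq yq xy vx vy.
have [w wp wv] : exists2 w, w \in p & w != v.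
  case/card_gt1P: p2 => a [b [ap bp ab]]; have [av|] := eqVneq a v; last by exists a.
  by exists b => //; rewrite -av eq_sym.
have [out|nout] := boolP [exists s in q, [&& s != x, s != y & [exists w0 in p, (w0 != v) && adj w0 s]]].
  case/exists_inP: out => s sq /and3P[sx sy /exists_inP[w0 w0p /andP[w0v w0s]]]; left.
  by apply: (@star23I _ _ _ v w0 x y s) => //; rewrite 1?eq_sym ?w0s ?orbT.
have inxy w0 s : w0 \in p -> w0 != v -> s \in q -> adj w0 s -> (s == x) || (s == y).
  move=> w0p w0v sq w0s; apply: contraR nout; rewrite negb_or => /andP[sx sy].
  by apply/exists_inP; exists s; rewrite ?sx ?sy //; apply/exists_inP; exists w0; rewrite ?w0v.
have wadj w0 : w0 \in p -> w0 != v -> adj w0 x || adj w0 y.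
  move=> w0p w0v; have [s sq w0s] := Hp w0 w0p.
  by case/orP: (inxy _ _ w0p w0v sq w0s) => /eqP <-; rewrite w0s ?orbT.
case/orP: pq3 => [p3|q3].
  have [w' w'p /andP[w'v w'w]] : exists2 w', w' \in p & (w' != v) && (w' != w).
    have : (0 < #|p :\ v :\ w|)%N.
      move: p3; rewrite (cardsD1 v) vp (cardsD1 w) !inE wv wp /=; lia.
    by case/card_gt0P => w'; rewrite !inE => /and3P[? ? ?]; exists w' => //; apply/andP.
  right; case/orP: (wadj w wp wv) => wx.
    apply: (@star23I _ _ _ x y v w w') => //; rewrite 1?eq_sym //; first exact: wadj.
    by rewrite /transp vy.
  apply: (@star23I _ _ _ y x v w w') => //; rewrite 1?eq_sym //.
    by rewrite orbC; apply: wadj.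
  by rewrite /transp vx.
have [s sq /andP[sx sy]] : exists2 s, s \in q & (s != x) && (s != y).
  have : (0 < #|q :\ x :\ y|)%N.
    move: q3; rewrite (cardsD1 x) xq (cardsD1 y) !inE yq eq_sym xy /=; lia.
  by case/card_gt0P => s; rewrite !inE => /and3P[? ? ?]; exists s => //; apply/andP.
left; apply: (@star23I _ _ _ v w x y s) => //; rewrite 1?eq_sym //.
  have [w0 w0p w0s] := Hq s sq; have [w0v|w0v] := eqVneq w0 v; first by rewrite -w0v w0s.
  by have := inxy _ _ w0p w0v sq w0s; rewrite (negbTE sx) (negbTE sy).
by case/orP: (wadj w wp wv) => ->; rewrite ?orbT.
Qed.

(** A vertex of degree at least two on either side is handled by [star23_degree2]. Without one, the
    graph is a perfect matching, with at least three edges. *)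
Lemma star23_or_matching p q adj :
  {in p, forall s, exists2 t, t \in q & adj s t} ->
  {in q, forall t, exists2 s, s \in p & adj s t} ->
  (1 < #|p|)%N -> (1 < #|q|)%N -> (2 < #|p|)%N || (2 < #|q|)%N ->
  [\/ star23 p q adj, star23 q p (transp adj) |
   exists s1 s2 s3 t1 t2 t3,
    [/\ [&& s1 \in p, s2 \in p, s3 \in p & uniq [:: s1; s2; s3]],
        [&& t1 \in q, t2 \in q, t3 \in q & uniq [:: t1; t2; t3]],
        [&& adj s1 t1, adj s2 t2 & adj s3 t3] &
        ~~ adj s2 t1 && ~~ adj s3 t1]].
Proof.
move=> Hp Hq p2 q2 pq3.
have [/exists_inP[v vp /exists_inP[x xq /exists_inP[y yq /and3P[xy vx vy]]]]|dp] :=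
  boolP [exists v in p, exists x in q, exists y in q, [&& x != y, adj v x & adj v y]].
  by case: (star23_degree2 Hp Hq p2 pq3 vp xq yq xy vx vy) => h; [constructor 1|constructor 2].
have [/exists_inP[v vq /exists_inP[x xp /exists_inP[y yp /and3P[xy vx vy]]]]|dq] :=
  boolP [exists v in q, exists x in p, exists y in p, [&& x != y, adj x v & adj y v]].
  have qp3 : (2 < #|q|)%N || (2 < #|p|)%N by rewrite orbC.
  by case: (@star23_degree2 q p (transp adj) v x y Hq Hp q2 qp3) => // h;
    [constructor 2|constructor 1].
have degp v x y : v \in p -> x \in q -> y \in q -> adj v x -> adj v y -> x = y.
  move=> vp xq yq vx vy; apply/eqP; apply: contraR dp => xy; apply/exists_inP; exists v => //.
  by apply/exists_inP; exists x => //; apply/exists_inP; exists y; rewrite // xy vx.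
have degq v x y : v \in q -> x \in p -> y \in p -> adj x v -> adj y v -> x = y.
  move=> vp xq yq vx vy; apply/eqP; apply: contraR dq => xy; apply/exists_inP; exists v => //.
  by apply/exists_inP; exists x => //; apply/exists_inP; exists y; rewrite // xy vx.
suff [s1 [s2 [s3 [t1 [t2 [t3 [H1 H2 H3]]]]]]] : exists s1 s2 s3 t1 t2 t3,
    [/\ [&& s1 \in p, s2 \in p, s3 \in p & uniq [:: s1; s2; s3]],
        [&& t1 \in q, t2 \in q, t3 \in q & uniq [:: t1; t2; t3]] &
        [&& adj s1 t1, adj s2 t2 & adj s3 t3]].
  constructor 3; exists s1, s2, s3, t1, t2, t3; split => //.
  case/and4P: H1 => s1p s2p s3p; rewrite /= !inE negb_or => /and3P[/andP[s12 s13] s23 _].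
  case/and4P: H2 => t1q t2q t3q _; case/and3P: H3 => a1 a2 a3.
  apply/andP; split.
    by apply: contra s12 => a; rewrite (degq t1 s1 s2).
  by apply: contra s13 => a; rewrite (degq t1 s1 s3).
case/orP: pq3 => /card_gt2P[x1 [x2 [x3 [[x1p x2p x3p] [x12 x23 x31]]]]].
  have [t1 t1q a1] := Hp _ x1p; have [t2 t2q a2] := Hp _ x2p; have [t3 t3q a3] := Hp _ x3p.
  exists x1, x2, x3, t1, t2, t3; split.
  - by rewrite x1p x2p x3p /= !inE negb_or x12 x23 eq_sym x31.
  - rewrite t1q t2q t3q /= !inE negb_or !andbT; apply/andP; split; first (apply/andP; split).
    + by apply: contra x12 => /eqP E; rewrite (degq t1 x1 x2) // E.
    + by apply: contra x31 => /eqP E; rewrite (degq t1 x1 x3) // E.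
    + by apply: contra x23 => /eqP E; rewrite (degq t2 x2 x3) // E.
  - by rewrite a1 a2.
have [t1 t1q a1] := Hq _ x1p; have [t2 t2q a2] := Hq _ x2p; have [t3 t3q a3] := Hq _ x3p.
exists t1, t2, t3, x1, x2, x3; split.
- rewrite t1q t2q t3q /= !inE negb_or !andbT; apply/andP; split; first (apply/andP; split).
  + by apply: contra x12 => /eqP E; rewrite (degp t1 x1 x2) // E.
  + by apply: contra x31 => /eqP E; rewrite (degp t1 x1 x3) // E.
  + by apply: contra x23 => /eqP E; rewrite (degp t2 x2 x3) // E.
- by rewrite x1p x2p x3p /= !inE negb_or x12 x23 eq_sym x31.
- by rewrite a1 a2.
Qed.

End Star.

(** * Grids from the fundamental graph of a basis *)

Section GridExistence.
Variables (n : nat) (M : matroid n).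

Definition swap (B : {set 'I_n}) b e := (B :\ b) :|: [set e].

Lemma exists_swap_out (B : {set 'I_n}) b : ~ is_coloop M b -> B \in bases M -> b \in B ->
  exists2 e, e \in ~: B & swap B b e \in bases M.
Proof.
move=> nco BM bB; have [B' B'M bB'] : exists2 B', B' \in bases M & b \notin B'.
  apply: NNPP => none; apply: nco => B' B'M; case: (boolP (b \in B')) => // h.
  by case: none; exists B'.
have bD : b \in B :\: B' by rewrite inE bB' bB.
have [e eD h] := bases_exchange BM B'M bD; exists e => //.
by move: eD; rewrite !inE => /andP[].
Qed.

(** Start from a basis containing [e] and exchange its other elements outside [B] for elements of
    [B]. Once [e] is the only element left outside, the basis differs from [B] by one swap. *)
Lemma exists_swap_in r (B : {set 'I_n}) e : has_rank M r -> ~ is_loop M e -> B \in bases M ->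
  e \in ~: B -> exists2 b, b \in B & swap B b e \in bases M.
Proof.
move=> hr nlo BM; rewrite inE => eB.
have [B' B'M eB'] : exists2 B', B' \in bases M & e \in B'.
  apply: NNPP => none; apply: nlo => B' B'M; case: (boolP (e \in B')) => // h.
  by case: none; exists B'.
move: {2}#|B' :\: B| (leqnn #|B' :\: B|) => m; elim: m B' B'M eB' => [|m IH] B' B'M eB' le.
  by move: le; rewrite leqn0 cards_eq0 setD_eq0 => /subsetP/(_ e eB'); rewrite (negbTE eB).
have [/eqP E|nE] := boolP (B' :\: B == [set e]).
  have cI : #|B :\: B'| = 1%N.
    apply/eqP; rewrite -(eqn_add2l #|B :&: B'|) cardsID (hr _ BM) -(hr _ B'M).
    by rewrite -(cardsID B B') E cards1 setIC.
  have [b Eb] := cards1P (introT eqP cI).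
  have bD : b \in B :\: B' by rewrite Eb inE.
  exists b; first by move: bD; rewrite inE => /andP[].
  suff -> : swap B b e = B' by [].
  apply/setP=> i; have := congr1 (fun S : {set _} => i \in S) E.
  have := congr1 (fun S : {set _} => i \in S) Eb; rewrite !inE.
  by move=> <- <-; case: (i \in B); case: (i \in B').
have [x xD xe] : exists2 x, x \in B' :\: B & x != e.
  have : (0 < #|(B' :\: B) :\ e|)%N.
    rewrite card_gt0; apply: contra nE => /eqP E0; rewrite eqEsubset.
    by rewrite -setD_eq0 E0 eqxx sub1set inE eB eB'.
  by case/card_gt0P => x; rewrite !inE => /and3P[? ? ?]; exists x; rewrite ?inE //; apply/andP.
have [y yD h] := bases_exchange B'M BM xD.
apply: (IH _ h); first by rewrite !inE eB' eq_sym xe.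
rewrite -ltnS (leq_trans _ le) // (cardsD1 x (B' :\: B)) xD add1n ltnS subset_leq_card //.
apply/subsetP=> i; rewrite !inE; have [->|_] := eqVneq i y.
  by move: yD; rewrite !inE => /andP[_ ->].
by rewrite orbF => /and3P[-> -> ->].
Qed.

Lemma pair_set_swap (e : bool) (V : seq 'I_n) (B : {set 'I_n}) s1 s2 t :
  s1 \in V -> s2 \in V -> t \in V -> s1 != s2 -> s1 != t -> s2 != t ->
  {in V, forall i, (i \in B) = e (+) (i \in [:: s1; s2])} ->
  pair_set e V B s1 t = if e then swap B t s2 else swap B s2 t.
Proof.
move=> s1V s2V tV s12 s1t s2t HB; apply/setP=> i; rewrite /swap.
have E : (i \in (if e then B :\ t :|: [set s2] else B :\ s2 :|: [set t])) =
   if e then (i != t) && (i \in B) || (i == s2) else (i != s2) && (i \in B) || (i == t).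
  by case: (e); rewrite !inE.
rewrite E !inE; have [iV|iV] := boolP (i \in V).
  rewrite HB // !inE; have [->|_] := eqVneq i s1.
    by rewrite (negbTE s12) (negbTE s1t); case: (e).
  have [->|_] := eqVneq i s2; first by rewrite (negbTE s2t); case: (e).
  by case: (e) => /=; rewrite ?orbF ?andbT ?andbF.
have niV a : a \in V -> (i == a) = false by move=> aV; apply: contraNF iV => /eqP ->.
by rewrite !niV //= !orbF; case: (e).
Qed.

(** On the five points of the pattern, [B] is the pair set of [s1] and [s2], and the swaps are the
    pair sets joining them to the [t]'s. The value [e = true] handles centres outside [B] by
    complementary triples. *)
Lemma star23_grid (e : bool) (B : {set 'I_n}) :
  B \in bases M ->
  star23 (if e then ~: B else B) (if e then B else ~: B)
    (fun s t => (if e then swap B t s else swap B s t) \in bases M) ->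
  segre_grid M.
Proof.
move=> BM [s1 [s2 [t1 [t2 [t3 [/and3P[s1p s2p s12] /and4P[t1q t2q t3q ut] Ht H1 H2]]]]]].
pose V := [:: s1; s2; t1; t2; t3].
have inS s : s \in (if e then ~: B else B) -> (s \in B) = ~~ e.
  by case: (e); rewrite ?inE // => /negbTE.
have inT t : t \in (if e then B else ~: B) -> (t \in B) = e.
  by case: (e); rewrite ?inE // => /negbTE.
have tq t : t \in [:: t1; t2; t3] -> t \in (if e then B else ~: B).
  by rewrite !inE => /or3P[] /eqP ->.
have st s t : s \in (if e then ~: B else B) -> t \in [:: t1; t2; t3] -> s != t.
  move=> /inS sB /tq/inT tB; apply/eqP => E; move: sB; rewrite E tB; by case: (e).
have uV : uniq V.
  rewrite /V cons_uniq cons_uniq ut andbT inE negb_or s12 /=.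
  by rewrite (contraTN (st s1 s1 s1p)) ?eqxx // (contraTN (st s2 s2 s2p)) ?eqxx.
have HB : {in V, forall i, (i \in B) = e (+) (i \in [:: s1; s2])}.
  move=> i; rewrite /V inE => /orP[/eqP ->|]; first by rewrite inS // !inE eqxx addbT.
  rewrite inE => /orP[/eqP ->|it]; first by rewrite inS // !inE eqxx orbT addbT.
  rewrite inT ?tq // !inE ![i == _]eq_sym (negbTE (st _ _ s1p it)) (negbTE (st _ _ s2p it)).
  by rewrite addbF.
have HB' : {in V, forall i, (i \in B) = e (+) (i \in [:: s2; s1])}.
  by move=> i iV; rewrite HB // !inE orbC.
have tV t : t \in [:: t1; t2; t3] -> t \in V by move=> h; rewrite /V 2!in_cons h !orbT.
have s1V : s1 \in V by rewrite /V !inE eqxx.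
have s2V : s2 \in V by rewrite /V !inE eqxx orbT.
have X1 t : t \in [:: t1; t2; t3] ->
    pair_set e V B s1 t = if e then swap B t s2 else swap B s2 t.
  by move=> h; exact: pair_set_swap s1V s2V (tV t h) s12 (st _ _ s1p h) (st _ _ s2p h) HB.
have X2 t : t \in [:: t1; t2; t3] ->
    pair_set e V B s2 t = if e then swap B t s1 else swap B s1 t.
  move=> h; have s21 : s2 != s1 by rewrite eq_sym.
  exact: pair_set_swap s2V s1V (tV t h) s21 (st _ _ s2p h) (st _ _ s1p h) HB'.
have [m1 m2 m3] : [/\ t1 \in [:: t1; t2; t3], t2 \in [:: t1; t2; t3] & t3 \in [:: t1; t2; t3]].
  by rewrite !inE !eqxx !orbT.
apply: (@five_point_grid n M e V B uV erefl s1 s2 t1 t2 t3 erefl).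
- suff -> : pair_set e V B s1 s2 = B by [].
  by apply/setP=> i; rewrite inE; case: ifP => // iV; rewrite HB.
- by move=> t h; rewrite X1 // X2 // orbC; apply: Ht.
- by rewrite !X1.
- by rewrite !X2.
Qed.

(** The rows are [B] and [B] with [s1] swapped for [t1]; the columns do nothing, swap [s2] for [t2],
    or swap [s3] for [t3]. A double swap is a basis because the only other outcome of the exchange,
    swapping [s2] or [s3] for [t1], is excluded. *)
Lemma matching_grid (B : {set 'I_n}) s1 s2 s3 t1 t2 t3 :
  B \in bases M ->
  [&& s1 \in B, s2 \in B, s3 \in B & uniq [:: s1; s2; s3]] ->
  [&& t1 \in ~: B, t2 \in ~: B, t3 \in ~: B & uniq [:: t1; t2; t3]] ->
  [&& swap B s1 t1 \in bases M, swap B s2 t2 \in bases M & swap B s3 t3 \in bases M] ->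
  (swap B s2 t1 \notin bases M) && (swap B s3 t1 \notin bases M) -> segre_grid M.
Proof.
move=> BM /and4P[s1B s2B s3B us] /and4P[]; rewrite !inE => t1B t2B t3B ut.
case/and3P=> b1 b2 b3 /andP[n2 n3].
move: us ut; rewrite /= !inE !negb_or => /and3P[/andP[s12 s13] s23 _] /and3P[/andP[t12 t13] t23 _].
have st s t : s \in B -> t \notin B -> s != t by move=> sB; apply: contraNneq => <-.
have double s t : s \in B -> t \notin B -> s1 != s -> t1 != t -> swap B s t \in bases M ->
    swap B s t1 \notin bases M -> swap (swap B s1 t1) s t \in bases M.
  move=> sB tB s1s t1t bs nb.
  have sD : s \in swap B s1 t1 :\: swap B s t.
    by rewrite /swap !inE eqxx sB [s == s1]eq_sym (negbTE s1s) (negbTE (st _ _ sB tB)).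
  have [y] := bases_exchange b1 bs sD; rewrite /swap !inE => yD h.
  have [Ey|yt] := eqVneq y t; first by rewrite /swap -Ey.
  case/negP: nb; suff <- : (B :\ s1 :|: [set t1]) :\ s :|: [set y] = swap B s t1 by [].
  have -> : y = s1.
    by apply/eqP; move: yD; rewrite (negbTE yt) orbF; case: (y == s1); case: (y == t1);
       case: (y \in B); rewrite ?andbF.
  apply/setP=> i; rewrite !inE; have [->|_] := eqVneq i s1; first by rewrite s1s s1B orbT.
  have [->|_] := eqVneq i s; first by rewrite (negbTE (st _ _ sB t1B)).
  by rewrite orbF.
have d2 := double _ _ s2B t2B s12 t12 b2 n2; have d3 := double _ _ s3B t3B s13 t13 b3 n3.
exists B, (swap B s2 t2), (swap B s3 t3), (swap B s1 t1),
  (swap (swap B s1 t1) s2 t2), (swap (swap B s1 t1) s3 t3).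
have F := (negbTE s12, negbTE s13, negbTE s23, negbTE (st _ _ s1B t1B), negbTE (st _ _ s1B t2B),
  negbTE (st _ _ s1B t3B), negbTE (st _ _ s2B t1B), negbTE (st _ _ s2B t2B),
  negbTE (st _ _ s2B t3B), negbTE (st _ _ s3B t1B), negbTE (st _ _ s3B t2B),
  negbTE (st _ _ s3B t3B)).
have Esum s t i : s \in B -> t \notin B -> s1 != s -> t1 != t ->
    ((i \in B) + (i \in swap (swap B s1 t1) s t) =
     (i \in swap B s t) + (i \in swap B s1 t1))%N.
  move=> sB tB s1s t1t; rewrite /swap !inE.
  have [->|_] := eqVneq i s1.
    by rewrite s1B (negbTE s1s) (negbTE (st _ _ s1B tB)) (negbTE (st _ _ s1B t1B)).
  have [->|_] := eqVneq i s.
    by rewrite sB (negbTE (st _ _ sB tB)) (negbTE (st _ _ sB t1B)).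
  have [->|_] := eqVneq i t1; first by rewrite (negbTE t1B) (negbTE t1t).
  have [->|_] := eqVneq i t; first by rewrite (negbTE tB).
  by rewrite !orbF.
split.
(* The six sets are told apart by which of [s1], [s2], [s3] they contain. *)
- apply: (map_uniq (f := fun C : {set 'I_n} => [:: s1 \in C; s2 \in C; s3 \in C])).
  by rewrite /= /swap !inE s1B s2B s3B !eqxx ![s2 == s1]eq_sym ![s3 == s1]eq_sym
    ![s3 == s2]eq_sym !F.
- by move=> C; rewrite !inE => /or4P[|||/or3P[]] /eqP ->.
- by move=> i; apply: Esum.
- move=> i; move: (Esum s2 t2 i s2B t2B s12 t12) (Esum s3 t3 i s3B t3B s13 t13).
  by do 6?case: (i \in _).
Qed.

(** In the fundamental graph of a basis, the absence of loops and coloops means that no vertex is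
    isolated; both sides have at least two vertices, and [n >= 5] gives one side at least three. *)
Lemma exists_segre_grid r : has_rank M r ->
  (forall e, ~ is_loop M e) -> (forall e, ~ is_coloop M e) ->
  (2 <= r)%N -> (r + 2 <= n)%N -> (5 <= n)%N -> segre_grid M.
Proof.
move=> hr nl nc r2 rn n5; have /set0Pn[B BM] := bases_nonempty M.
have cB := hr _ BM; have cC : (#|B| + #|~: B| = n)%N by rewrite cardsC card_ord.
have := @star23_or_matching _ B (~: B) (fun b e => swap B b e \in bases M).
case.
- by move=> b bB; apply: exists_swap_out.
- by move=> e eB; apply: exists_swap_in hr _ BM eB.
- by rewrite cB.
- by move: cC; rewrite cB; lia.
- by move: cC; rewrite cB; lia.
- exact: (@star23_grid false).
- exact: (@star23_grid true).
case=> s1 [s2 [s3 [t1 [t2 [t3 [H1 H2 H3 H4]]]]]].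
exact: matching_grid BM H1 H2 H3 H4.
Qed.

End GridExistence.

(** * Small cases *)

(** Each basis misses exactly one element, so the exponent of its variable is the degree minus the
    exponent of that element in the image. Every fibre is thus a single monomial. *)
Lemma toric_ideal_corank1 (k : fieldType) n r (M : matroid n) p :
  has_rank M r -> (0 < r)%N -> n = r.+1 -> @toric_ideal k n M p -> p = 0.
Proof.
move=> hr r0 nr Ip; apply/mpolyP=> m; rewrite mcoeff0.
apply: toric_ideal_coeff_eq0 Ip => u Eum; apply/mnmP=> j.
have dE : mdeg u = mdeg m.
  have /eqP := congr1 (@mdeg n) Eum.
  by rewrite !(mdeg_mon_image _ hr) eqn_pmul2l // => /eqP.
have comp1 (l : 'I_#|bases M|) : exists i, ~: (enum_val l : {set 'I_n}) = [set i].
  apply/cards1P; rewrite -(eqn_add2l #|(enum_val l : {set 'I_n})|) cardsC card_ord.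
  by rewrite (hr _ (enum_valP l)) nr addn1.
have [i Ei] := comp1 j.
have inE' (l : 'I_#|bases M|) : (i \in (enum_val l : {set 'I_n})) = (l != j).
  have [->|lj] := eqVneq l j.
    by have := set11 i; rewrite -Ei inE => /negbTE.
  apply: contraR lj; rewrite -in_setC; have [i' Ei'] := comp1 l.
  rewrite Ei' inE => /eqP Eii'; apply/eqP/enum_val_inj/setC_inj.
  by rewrite Ei Ei' Eii'.
have split_deg (w : 'X_{1.. #|bases M|}) : mdeg w = (w j + mon_image w i)%N.
  rewrite mdegE (bigD1 j) //= mon_imageE [in RHS](bigD1 j) //= inE' eqxx mul0n add0n.
  by congr addn; apply: eq_bigr => l lj; rewrite inE' lj mul1n.
by move: dE; rewrite !split_deg Eum => /eqP; rewrite eqn_add2r => /eqP.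
Qed.

(** * Classification in rank two on four elements *)

Section RankTwoOnFour.
Variable M : matroid 4.
Hypotheses (hr : has_rank M 2).

Lemma relabel_of_pairs fam (q : 'I_4 -> 'I_4) : injective q ->
  all (fun L => has (fun i => has (fun j => (i != j) && (L == [:: i.+1; j.+1])) (iota 0 4))
    (iota 0 4)) fam ->
  (forall i j : 'I_4, (i < j)%N -> ([set q i; q j] \in bases M) =
     ([:: i.+1; j.+1] \in fam) || ([:: j.+1; i.+1] \in fam)) ->
  bases_up_to_relabel M fam.
Proof.
(* [q] sends labels to elements, whereas a relabelling sends elements to labels, hence the
   inverse. *)
move=> qI famP tab; pose s := (perm qI)^-1%g.
have sq i : s (q i) = i by rewrite -[q i](permE qI) permK.
have qs i : q (s i) = i by rewrite -[q _](permE qI) permKV.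
have setE (i j : 'I_4) : [set l | (val (s l)).+1 \in [:: i.+1; j.+1]] = [set q i; q j].
  apply/setP=> l; rewrite !inE !eqSS !val_eqE.
  by rewrite -(inj_eq qI) -[s l == j](inj_eq qI) !qs.
have tab' (i j : 'I_4) : i != j -> ([set q i; q j] \in bases M) =
     ([:: i.+1; j.+1] \in fam) || ([:: j.+1; i.+1] \in fam).
  rewrite -val_eqE neq_ltn => /orP[/tab //|/tab h].
  by rewrite setUC h orbC.
exists s => B; apply/idP/hasP => [BM|[L Lf /eqP ->]].
  have /cards2P[u [v [uv EB]]] : #|B| == 2%N by rewrite (hr BM).
  have := BM; rewrite EB -(qs u) -(qs v) tab'; last by rewrite -(inj_eq qI) !qs.
  case/orP=> h; [exists [:: (s u).+1; (s v).+1]|exists [:: (s v).+1; (s u).+1]] => //.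
    by rewrite setE.
  by rewrite setE setUC.
have /hasP[i] := allP famP _ Lf; rewrite mem_iota => i4 /hasP[j]; rewrite mem_iota => j4.
case/andP=> ij /eqP EL; have := setE (Ordinal (i4 : i < 4)%N) (Ordinal (j4 : j < 4)%N).
rewrite /= EL => ->; rewrite tab' -?val_eqE //= -EL; by rewrite Lf.
Qed.

Hypotheses (nl : forall e, ~ is_loop M e) (nc : forall e, ~ is_coloop M e).

Local Notation pair u v := ([set u; v] \in bases M).

(** The case of [pair_set_exchange] with no contraction; looplessness supplies the partner [z] of
    [v]. *)
Lemma pair_trans (u w v : 'I_4) : v != u -> v != w -> u != w -> pair u w ->
  pair v u || pair v w.
Proof.
move=> vu vw uw b.
have [z zv bz] : exists2 z, z != v & pair v z.
  apply: NNPP => none; case: (nl (e := v)) => B BM; apply/negP => vB; apply: none.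
  have /cards2P[x [y [xy EB]]] : #|B| == 2%N by rewrite (hr BM).
  move: vB; rewrite EB !inE => /orP[]/eqP ->; first by exists y; rewrite // -?EB // eq_sym.
  by exists x; rewrite // setUC -EB.
have PE (x y : 'I_4) : pair_set false (enum 'I_4) set0 x y = [set x; y].
  by apply/setP=> i; rewrite !inE mem_enum.
have := @pair_set_exchange 4 M false (enum 'I_4) set0 u w v z; rewrite !PE !mem_enum.
exact.
Qed.

(* Three parallel elements would make the fourth one a coloop. *)
Lemma parallel_pair_cross (a b c d : 'I_4) : uniq [:: a; b; c; d] -> ~~ pair a b -> pair a c.
Proof.
rewrite /= !inE !negb_or -!andbA => /and5P[ab ac ad bc /and3P[bd cd _]] nab.
case: (boolP (pair a c)) => // nac.
have nbc : ~~ pair b c.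
  apply/negP => h; have := pair_trans ab ac bc h.
  by rewrite (negbTE nab) (negbTE nac).
case: (nc (e := d)) => B BM; apply: contraT => dB.
have Bsub : B \subset [set a; b; c].
  have full : [set a; b; c; d] = setT.
    apply/eqP; rewrite eqEcard subsetT cardsT card_ord /= -!setUA !cardsU1 cards1 !inE.
    by rewrite !negb_or ab ac ad bc bd cd.
  apply/subsetP=> i iB; have : i \in [set a; b; c; d] by rewrite full inE.
  rewrite !inE; have [E|_] := eqVneq i d; last by rewrite orbF.
  by rewrite -E iB in dB.
have /cards2P[x [y [xy EB]]] : #|B| == 2%N by rewrite (hr BM).
move: Bsub BM; rewrite EB subUset !sub1set !inE => /andP[].
case/orP=> [/orP[]|] /eqP Ex; case/orP=> [/orP[]|] /eqP Ey; move: xy; rewrite Ex Ey ?eqxx //.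
- by rewrite (negbTE nab).
- by rewrite (negbTE nac).
- by rewrite setUC (negbTE nab).
- by rewrite (negbTE nbc).
- by rewrite setUC (negbTE nac).
- by rewrite setUC (negbTE nbc).
Qed.

(** If some pair [a], [b] is not a basis, the four pairs joining it to the other two elements are
    bases, and only the pair of those two is undecided. *)
Lemma rank2_on4_classification :
  [\/ bases_up_to_relabel M fam1, bases_up_to_relabel M fam2 | bases_up_to_relabel M fam3].
Proof.
have [/existsP[a /existsP[b /andP[ab nab]]]|/existsPn unif] :=
  boolP [exists a : 'I_4, exists b : 'I_4, (a != b) && ~~ pair a b].
  have : #|~: [set a; b]| == 2%N.
    by rewrite -(eqn_add2l #|[set a; b]|) cardsC card_ord cards2 ab.
  case/cards2P=> c [d [cd Ecd]].
  have [/andP[ca cb] /andP[da db]] : (c != a) && (c != b) /\ (d != a) && (d != b).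
    have := congr1 (fun S : {set _} => (c \in S, d \in S)) Ecd.
    by rewrite !inE !eqxx orbT !negb_or => -[-> ->].
  have flip (x y : 'I_4) : x != y -> y != x by rewrite eq_sym.
  have U := (ab, flip _ _ ab, cd, flip _ _ cd, ca, flip _ _ ca, cb, flip _ _ cb,
             da, flip _ _ da, db, flip _ _ db).
  have ac : pair a c.
    by apply: (@parallel_pair_cross a b c d); rewrite // /= !inE !negb_or !U.
  have ad : pair a d.
    by apply: (@parallel_pair_cross a b d c); rewrite // /= !inE !negb_or !U.
  have bc : pair b c.
    by apply: (@parallel_pair_cross b a c d); rewrite 1?setUC // /= !inE !negb_or !U.
  have bd : pair b d.
    by apply: (@parallel_pair_cross b a d c); rewrite 1?setUC // /= !inE !negb_or !U.
  (* The non-basis [a], [b] receives the labels 2 and 3, and the undecided pair [c], [d] the labels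
     1 and 4. *)
  pose q (i : 'I_4) := nth a [:: c; a; b; d] i.
  have qI : injective q.
    move=> i j /eqP; rewrite /q nth_uniq // => [/eqP/val_inj //|].
    by rewrite /= !inE !negb_or !U.
  have ca' : pair c a by rewrite setUC.
  have cb' : pair c b by rewrite setUC.
  have [bcd|/negbTE bcd] := boolP (pair c d); [constructor 2|constructor 1];
    apply: (relabel_of_pairs qI) => // -[[|[|[|[|//]]]] ?] [[|[|[|[|//]]]] ?] //= _;
    by rewrite /q /= ?bcd ?ca' ?ad ?cb' ?bd ?(negbTE nab).
constructor 3; apply: (@relabel_of_pairs _ id) => // i j ij.
have := unif i; rewrite negb_exists => /forallP/(_ j); rewrite negb_and negbK -val_eqE.
rewrite (ltn_eqF ij) /= negbK => ->.
by move: i j ij => [[|[|[|[|//]]]] ?] [[|[|[|[|//]]]] ?].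
Qed.

End RankTwoOnFour.

(** * The three families on four elements *)

Section ToricGenerators.
Variables (k : fieldType) (n : nat) (M : matroid n).
Local Notation N := #|bases M|.
Local Notation I := (@toric_ideal k n M).
Local Notation R := {mpoly k[N]}.
Local Notation mon := 'X_{1.. N}.

(* Each monomial of [p] is replaced by the first monomial of [p] with the same image; the result
   vanishes together with the image of [p]. *)
Lemma toric_ideal_sub (J : R -> Prop) p : is_ideal J ->
  (forall u v : mon, mon_image u = mon_image v -> J ('X_[u] - 'X_[v])) -> I p -> J p.
Proof.
move=> idJ Jbin Ip; have [J0 JD JM] := idJ.
pose S := msupp p.
pose rep a := nth 0%MM S (find (fun u : mon => mon_image u == a) S).
have repE u : u \in S -> mon_image (rep (mon_image u)) = mon_image u.
  move=> uS; apply/eqP; apply: (nth_find 0%MM (a := fun w : mon => mon_image w == mon_image u)).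
  by apply/hasP; exists u.
have rep0 : \sum_(u <- S) p@_u *: 'X_[rep (mon_image u)] = 0 :> R.
  apply/mpolyP=> m; rewrite mcoeff0 raddf_sum /=.
  under eq_bigr => u _ do rewrite mcoeffZ mcoeffX.
  have [/hasP[u0 u0S /eqP Em]|none] := boolP (has (fun u => rep (mon_image u) == m) S).
    transitivity (toric_map p)@_(mon_image m); last by rewrite Ip mcoeff0.
    rewrite mcoeff_toric_map [RHS]big_mkcond big_seq [RHS]big_seq; apply: eq_bigr => u uS.
    have -> : (rep (mon_image u) == m) = (mon_image u == mon_image m).
      apply/eqP/eqP => [<-|->]; first by rewrite repE.
      by rewrite -{1}Em repE.
    by case: eqP; rewrite ?mulr1 ?mulr0.
  rewrite big_seq big1 // => u uS; case: eqP => [E|]; last by rewrite mulr0.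
  by case/hasP: none; exists u => //; apply/eqP.
rewrite -[p]subr0 -rep0 {1}[p]mpolyE -sumrB; apply: ideal_sum => // u uS.
by rewrite -scalerBr -mul_mpolyC; apply/JM/Jbin; rewrite repE.
Qed.

Lemma toric_generated (gs : seq R) : (forall g, g \in gs -> I g) ->
  (forall u v : mon, mon_image u = mon_image v -> span_ideal gs ('X_[u] - 'X_[v])) ->
  generated_by I gs.
Proof.
move=> gsI bin x; split; first exact: toric_ideal_sub (span_ideal_is_ideal gs) bin.
have [[_ ID IM] _ _] := toric_ideal_prime k M.
case=> c ->; elim/big_ind: _ => [|//|i _]; first by have [[]] := toric_ideal_prime k M.
by apply/IM/gsI/mem_nth.
Qed.

Lemma toric_ideal_binomial u v : I ('X_[u] - 'X_[v]) -> mon_image u = mon_image v.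
Proof.
rewrite /toric_ideal toric_mapB !toric_mapX => /(congr1 (mcoeff (mon_image u))).
rewrite mcoeffB !mcoeffX eqxx mcoeff0 eq_sym; case: eqP => // _ /eqP.
by rewrite subr0 oner_eq0.
Qed.

(** The product of the variables [a], [b] is rewritten to that of [c], [d] as often as it divides,
    which is [minn (u a) (u b)] times; a difference of [t]-th powers is a multiple of the
    difference. *)
Lemma exchange_step (J : R -> Prop) (a b c d : 'I_N) (u : mon) : is_ideal J ->
  J ('X_[U_(a) + U_(b)] - 'X_[U_(c) + U_(d)]) -> uniq [:: a; b; c; d] ->
  exists u' : mon, [/\ J ('X_[u] - 'X_[u']), u' a = 0%N \/ u' b = 0%N &
    forall j, j \notin [:: a; b; c; d] -> u' j = u j].
Proof.
move=> [_ _ JM] Jf; rewrite /= !inE !negb_or -!andbA => /and5P[ab ac ad bc /and3P[bd cd _]].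
pose t := minn (u a) (u b); pose w := (u - (U_(a) + U_(b)) *+ t)%MM.
have flip (x y : 'I_N) : x != y -> (x == y = false) * (y == x = false).
  by move=> xy; rewrite [y == x]eq_sym (negbTE xy).
have F := (flip _ _ ab, flip _ _ ac, flip _ _ ad, flip _ _ bc, flip _ _ bd, flip _ _ cd).
have Eu : u = (w + (U_(a) + U_(b)) *+ t)%MM.
  rewrite submK //; apply/mnm_lepP => i; rewrite mulmnE mnmDE !mnm1E.
  have [<-|_] := eqVneq a i; first by rewrite F mul1n geq_minl.
  by have [<-|_] := eqVneq b i; rewrite ?mul1n ?geq_minr.
exists (w + (U_(c) + U_(d)) *+ t)%MM; split.
- rewrite {1}Eu (mpolyXD _ w ((U_(a) + U_(b)) *+ t)) (mpolyXD _ w ((U_(c) + U_(d)) *+ t)).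
  by rewrite -mulrBr -!mpolyXn subrXX mulrCA mulrC; apply: JM.
- rewrite !mnmDE !mulmnE !mnmBE !mulmnE !mnmDE !mnm1E !eqxx !F /= !(addn0, add0n, mul0n, mul1n).
  by rewrite /t; case: (leqP (u a) (u b)) => h; [left|right]; rewrite subnn.
- move=> j; rewrite !inE !negb_or => /and4P[ja jb jc jd].
  have G := (flip _ _ ja, flip _ _ jb, flip _ _ jc, flip _ _ jd).
  by rewrite !mnmDE !mulmnE !mnmBE !mulmnE !mnmDE !mnm1E !G /= !(addn0, mul0n, subn0).
Qed.

End ToricGenerators.

(** Coordinates for the families: [p] takes a label to its element and [idx] a listed set to its
    variable, so that images are computed from the list alone. *)
Lemma relabel_indices (M : matroid 4) fam : bases_up_to_relabel M fam -> fam != [::] ->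
  uniq [seq [seq i.+1 \in L | i <- iota 0 4] | L : seq nat <- fam] ->
  exists (p : 'I_4 -> 'I_4) (idx : seq nat -> 'I_#|bases M|),
    [/\ uniq (map idx fam), forall j, j \in map idx fam, forall i, exists i0, i = p i0,
      forall i L, L \in fam -> (p i \in (enum_val (idx L) : {set 'I_4})) = (i.+1 \in L) &
      forall u i, mon_image u (p i) = (\sum_(L <- fam) (i.+1 \in L) * u (idx L))%N].
Proof.
move=> [s Hs] fam0 ufam.
pose p i := (s^-1)%g i; pose setL (L : seq nat) := [set i : 'I_4 | (val (s i)).+1 \in L].
have pL i L : (p i \in setL L) = (i.+1 \in L) by rewrite inE permKV.
have LM L : L \in fam -> setL L \in bases M.
  by move=> Lf; rewrite Hs; apply/hasP; exists L.
have [L0 L0f] : exists L0, L0 \in fam.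
  by case: (fam) fam0 => // L l _; exists L; rewrite mem_head.
pose idx L := enum_rank_in (LM L0 L0f) (setL L).
have idxK L : L \in fam -> enum_val (idx L) = setL L.
  by move=> Lf; rewrite enum_rankK_in ?LM.
have uidx : uniq (map idx fam).
  apply: (map_uniq (f := fun j => [seq p i \in (enum_val j : {set 'I_4}) | i <- enum 'I_4])).
  move: ufam; congr uniq; rewrite -map_comp; apply/eq_in_map => L Lf; rewrite [RHS]/comp.
  rewrite (idxK L Lf) -(val_enum_ord 4) -map_comp.
  by apply: eq_map => i; rewrite pL.
have allidx j : j \in map idx fam.
  have := enum_valP j; rewrite Hs => /hasP[L Lf /eqP E].
  by apply/mapP; exists L => //; apply: enum_val_inj; rewrite idxK.
exists p, idx; split => //.
- by move=> i; exists (s i); rewrite /p permK.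
- by move=> i L Lf; rewrite (idxK L Lf) pL.
move=> u i.
rewrite mon_imageE (perm_big (map idx fam)) /=; last first.
  by apply: uniq_perm (index_enum_uniq _) uidx _ => j; rewrite mem_index_enum allidx.
rewrite big_map big_seq [RHS]big_seq; apply: eq_bigr => L Lf.
by rewrite (idxK L Lf) pL.
Qed.

(** * Normal forms, heights and chains on four elements *)

Section Quadrilateral.
Variables (k : fieldType) (M : matroid 4).
Local Notation N := #|bases M|.
Local Notation I := (@toric_ideal k 4 M).
Local Notation R := {mpoly k[N]}.
Local Notation mon := 'X_{1.. N}.
Variables (p : 'I_4 -> 'I_4) (j12 j34 j13 j24 : 'I_N) (w14 w23 : mon -> nat).

(* [w14] and [w23] are the exponents of the remaining bases, and [0] when these are absent. *)
Hypothesis images : forall u : mon,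
  [/\ mon_image u (p (inord 0)) = (u j12 + u j13 + w14 u)%N,
      mon_image u (p (inord 1)) = (u j12 + u j24 + w23 u)%N,
      mon_image u (p (inord 2)) = (u j34 + u j13 + w23 u)%N &
      mon_image u (p (inord 3)) = (u j34 + u j24 + w14 u)%N].
Hypothesis ext : forall u v : mon, u j12 = v j12 -> u j34 = v j34 -> u j13 = v j13 ->
  u j24 = v j24 -> w14 u = w14 v -> w23 u = w23 v -> u = v.

(** Normal forms for rewriting the products of opposite pairs 12, 34 and 14, 23 into the product of
    13 and 24. *)
Definition reduced (u : mon) := (u j12 = 0 \/ u j34 = 0)%N /\ (w14 u = 0 \/ w23 u = 0)%N.

(** Equal images force the same change at [j12] and [j34], and the same at [w14] and [w23].
    Reducedness makes the minimum zero in each couple, so both changes vanish and the other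
    exponents follow. *)
Lemma reduced_inj u v : mon_image u = mon_image v -> reduced u -> reduced v -> u = v.
Proof.
move=> E [ru1 ru2] [rv1 rv2].
have [u1 u2 u3 u4] := images u; have [v1 v2 v3 v4] := images v.
move: u1 u2 u3 u4; rewrite E v1 v2 v3 v4 => u1 u2 u3 u4.
move: (@ext u v); move: (u j12) (u j34) (u j13) (u j24) (w14 u) (w23 u) ru1 ru2 u1 u2 u3 u4.
move: (v j12) (v j34) (v j13) (v j24) (w14 v) (w23 v) rv1 rv2.
move=> a1 a2 a3 a4 a5 a6 {}rv1 {}rv2 b1 b2 b3 b4 b5 b6 {}ru1 {}ru2 {}u1 {}u2 {}u3 {}u4 H; apply: H; lia.
Qed.

(** Monomials in the variables [l] are all reduced, so these variables are independent modulo the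
    ideal and the height is at most [h]. Monomials with equal image reduce to the same normal form,
    so [gs] generates. *)
Lemma ci_of_reduction gs h (l : seq 'I_N) :
  (forall g, g \in gs -> I g) ->
  (forall u, exists2 u', span_ideal gs ('X_[u] - 'X_[u']) & reduced u') ->
  uniq l -> (size l + h)%N = N ->
  (forall u : mon, (forall j, j \notin l -> u j = 0%N) -> reduced u) ->
  size gs = h -> prime_chain_to I h ->
  (forall gs' : seq R, generated_by I gs' -> (h <= size gs')%N) ->
  (exists x, I x /\ x <> 0) -> complete_intersection I.
Proof.
move=> gsI red ul sl redl sgs ch low nz; split => //; exists h; split; first split=> //.
- move=> ch'; have := @toric_chain_bound k 4 M h.+1 (size l) (tnth (in_tuple l)) _ _ ch'.
  rewrite addnS sl ltnn => H; suff: false by [].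
  apply: H; first exact/tuple_uniqP.
  move=> u v uv E; apply: reduced_inj E _ _; apply: redl => j jl;
    have jc : j \notin codom (tnth (in_tuple l)).
  + by apply: contra jl => /codomP[i ->]; apply: mem_tnth.
  + by have [] := uv j jc.
  + by apply: contra jl => /codomP[i ->]; apply: mem_tnth.
  + by have [] := uv j jc.
- split=> //; exists gs => //; apply: toric_generated => // u v E.
  have [u' uu' ru'] := red u; have [v' vv' rv'] := red v.
  have inI w w' : span_ideal gs ('X_[w] - 'X_[w']) -> mon_image w = mon_image w'.
    move=> [c Ec]; apply: (@toric_ideal_binomial k); rewrite Ec.
    have [[I0 ID IM] _ _] := toric_ideal_prime k M.
    elim/big_ind: _ => [|//|i _]; first exact: I0.
    by apply: IM; apply: gsI; apply: mem_nth.
  have Euv : u' = v' by apply: reduced_inj => //; rewrite -(inI _ _ uu') -(inI _ _ vv').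
  have [_ JD JM] := span_ideal_is_ideal gs.
  have -> : 'X_[u] - 'X_[v] = ('X_[u] - 'X_[u']) + (-1) * ('X_[v] - 'X_[v']) :> R.
    by rewrite mulN1r opprB Euv addrA subrK.
  exact/JD/JM.
Qed.

Lemma binomial_neq0 (a b c d : 'I_N) : (a != c) && (a != d) ->
  ('X_[U_(a) + U_(b)] - 'X_[U_(c) + U_(d)] : R) <> 0.
Proof.
move=> acd /(congr1 (mcoeff (U_(a) + U_(b)))).
rewrite mcoeffB !mcoeffX eqxx mnm_pair_neq // mcoeff0 subr0 => /eqP.
by rewrite oner_eq0.
Qed.

Lemma zero_ideal_prime : is_prime_ideal (fun x : R => x = 0).
Proof.
split; first split=> //.
- by move=> a b -> ->; rewrite addr0.
- by move=> a b ->; rewrite mulr0.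
- by apply/eqP; rewrite oner_eq0.
- by move=> a b /eqP; rewrite mulf_eq0 => /orP[]/eqP; [left|right].
Qed.

Lemma toric_chain1 x : I x -> x <> 0 -> prime_chain_to I 1.
Proof.
move=> Ix x0; exists (fun i => if i == 0%N then (fun y => y = 0) else I); split=> //.
- by case=> [|i] _; [exact: zero_ideal_prime|exact: toric_ideal_prime].
- case=> // _; split; last by exists x.
  by move=> y ->; have [[]] := toric_ideal_prime k M.
Qed.

Lemma generators_size_gt0 x : I x -> x <> 0 ->
  forall gs : seq R, generated_by I gs -> (1 <= size gs)%N.
Proof.
move=> Ix x0 [|//] gen; have [c] := (gen x).1 Ix.
by rewrite big_ord0.
Qed.

(* Weighting [y_j] by an extra variable gives a prime strictly between [0] and the toric
   ideal. *)
Definition weighted_map (j : 'I_N) (x : R) : {poly {mpoly k[4]}} :=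
  mmap (@polyC _ \o @mpolyC 4 k)
    (fun i => (basis_monomial k i)%:P * (if i == j then 'X else 1)) x.

Lemma weighted_mapX j u : weighted_map j 'X_[u] = ('X_[mon_image u])%:P * 'X^(u j).
Proof.
rewrite /weighted_map mmapX /mmap1 (eq_bigr (fun i => ((basis_monomial k i) ^+ u i)%:P *
  (if i == j then 'X^(u j) else 1))); last first.
  move=> i _; rewrite exprMn rmorphXn; congr (_ * _).
  by case: eqP => [->|]; rewrite ?expr1n.
rewrite big_split /= -big_mkcond /= big_pred1_eq -rmorph_prod; congr (_%:P * _).
by rewrite -toric_mapX toric_mapE mmapX.
Qed.

Lemma weighted_map1 j x : (weighted_map j x).[1] = toric_map x.
Proof.
rewrite [x]mpolyE toric_map_sum /weighted_map raddf_sum horner_sum.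
apply: eq_bigr => u _; rewrite toric_mapZ toric_mapX /= mmapZ.
have := weighted_mapX j u; rewrite /weighted_map => ->.
by rewrite /= !hornerE expr1n -[RHS]mul_mpolyC; exact: mulr1.
Qed.

(** The first binomial, balanced at [j], separates the kernel of the weighted map from 0; the
    second, unbalanced at [j], separates the toric ideal from that kernel. *)
Lemma toric_chain2 j (a b c d : mon) : mon_image a = mon_image b -> mon_image c = mon_image d ->
  a j = b j -> c j <> d j -> 'X_[a] - 'X_[b] <> 0 :> R -> prime_chain_to I 2.
Proof.
move=> ab cd abj cdj nz; pose P x := weighted_map j x = 0.
have PI x : P x -> I x by rewrite /P /toric_ideal -(weighted_map1 j) => ->; rewrite horner0.
have prP : is_prime_ideal P.
  split; first split.
  - by rewrite /P /weighted_map mmap0.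
  - by move=> x y; rewrite /P /weighted_map mmapD => -> ->; rewrite addr0.
  - by move=> x y; rewrite /P /weighted_map rmorphM /= => ->; rewrite mulr0.
  - by rewrite /P /weighted_map rmorph1; apply/eqP; rewrite oner_eq0.
  - move=> x y; rewrite /P /weighted_map rmorphM /= => /eqP.
    by rewrite mulf_eq0 => /orP[]/eqP; [left|right].
exists (fun i => if i == 0%N then (fun y => y = 0) else if i == 1%N then P else I); split=> //.
- by case=> [|[|i]] _; [exact: zero_ideal_prime| |exact: toric_ideal_prime].
- case=> [|[|//]] _; split=> //.
  + by move=> y ->; have [[]] := prP.
  + exists ('X_[a] - 'X_[b]); split=> //.
    by rewrite /= /P /weighted_map mmapB -!/(weighted_map j _) !weighted_mapX ab abj subrr.
  + exists ('X_[c] - 'X_[d]); split; first exact: toric_idealX.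
    rewrite /= /P /weighted_map mmapB -!/(weighted_map j _) !weighted_mapX cd -mulrBr => /eqP.
    have X0 : 'X_[mon_image d] != 0 :> {mpoly k[4]}.
      by apply/eqP => /(congr1 (mcoeff (mon_image d)))/eqP; rewrite mcoeffX eqxx mcoeff0 oner_eq0.
    rewrite mulf_eq0 polyC_eq0 (negbTE X0) /= subr_eq0 => /eqP/(congr1 (coefp (c j))).
    by rewrite /= !coefXn eqxx; case: eqP => // _ /eqP; rewrite oner_eq0.
Qed.

End Quadrilateral.

Lemma uniq_all_size N (s : seq 'I_N) : uniq s -> (forall j, j \in s) -> size s = N.
Proof.
by move=> us alls; rewrite -(card_uniqP us) (eq_card (B := 'I_N)) ?card_ord // => j; rewrite alls.
Qed.

Lemma uniq_map_inj_in (T1 T2 : eqType) (g : T1 -> T2) (s : seq T1) :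
  uniq (map g s) -> {in s &, injective g}.
Proof.
elim: s => // a s IH /= /andP[ga us] x y.
rewrite !inE => /orP[/eqP ->|xs] /orP[/eqP ->|ys] // E; last exact: IH.
  by case/negP: ga; rewrite E map_f.
by case/negP: ga; rewrite -E map_f.
Qed.

(** * The three families are complete intersections *)

Section Families.
Variables (k : fieldType) (M : matroid 4).
Hypothesis (hr : has_rank M 2).
Local Notation N := #|bases M|.
Local Notation I := (@toric_ideal k 4 M).
Local Notation R := {mpoly k[N]}.
Local Notation mon := 'X_{1.. N}.

Lemma family_binomial (fam : seq (seq nat)) (p : 'I_4 -> 'I_4) (idx : seq nat -> 'I_N) a b c d :
  (forall i, exists i0, i = p i0) ->
  (forall i L, L \in fam -> (p i \in (enum_val (idx L) : {set 'I_4})) = (i.+1 \in L)) ->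
  a \in fam -> b \in fam -> c \in fam -> d \in fam ->
  all (fun i => ((i.+1 \in a) + (i.+1 \in b) == (i.+1 \in c) + (i.+1 \in d))%N) (iota 0 4) ->
  mon_image (U_(idx a) + U_(idx b))%MM = mon_image (U_(idx c) + U_(idx d))%MM.
Proof.
move=> psurj pE af bf cf df H; apply/mnmP=> i; have [i0 ->] := psurj i.
rewrite !mon_imageD !mnmDE !mon_imageU !pE //; apply/eqP.
by apply: (allP H); rewrite mem_iota /= ltn_ord.
Qed.

Lemma idx_uniq (fam l : seq (seq nat)) (idx : seq nat -> 'I_N) :
  uniq (map idx fam) -> all (mem fam) l -> uniq l -> uniq (map idx l).
Proof.
move=> /uniq_map_inj_in inj /allP lf ul; rewrite map_inj_in_uniq // => x y /lf xf /lf yf.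
exact: inj.
Qed.

Lemma idx_neq (fam : seq (seq nat)) (idx : seq nat -> 'I_N) a b :
  uniq (map idx fam) -> a \in fam -> b \in fam -> a != b -> idx a != idx b.
Proof. by move=> /uniq_map_inj_in inj af bf; rewrite (inj_in_eq inj). Qed.

Lemma fam1_ci : bases_up_to_relabel M fam1 -> complete_intersection I.
Proof.
move=> /relabel_indices [] // p [idx [uidx allidx psurj pE img]].
pose j12 := idx [:: 1; 2]%N; pose j34 := idx [:: 3; 4]%N.
pose j13 := idx [:: 1; 3]%N; pose j24 := idx [:: 2; 4]%N.
have im1 : mon_image (U_(j12) + U_(j34))%MM = mon_image (U_(j13) + U_(j24))%MM.
  exact: (family_binomial psurj pE).
pose f1 : R := 'X_[U_(j12) + U_(j34)] - 'X_[U_(j13) + U_(j24)].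
have If1 : I f1 by apply: toric_idealX.
have f10 : f1 <> 0 by apply: binomial_neq0; rewrite !(idx_neq uidx).
apply: (@ci_of_reduction k M p j12 j34 j13 j24 (fun _ => 0%N) (fun _ => 0%N) _ _
  [:: f1] 1 [:: j12; j13; j24]) => //.
- by move=> u; split; rewrite img !big_cons big_nil inordK // !inE /= !(mul1n, mul0n, addn0, add0n).
- move=> u v e1 e2 e3 e4 _ _; apply/mnmP=> j; have := allidx j.
  by rewrite !inE => /or4P[] /eqP ->.
- by move=> g; rewrite inE => /eqP ->.
- move=> u; have [u' [uu' r1 _]] := exchange_step u (span_ideal_is_ideal [:: f1])
    (span_ideal_nth (gs := [:: f1]) (i := 0) isT) uidx.
  by exists u' => //; split=> //; left.
- exact: (idx_uniq (l := [:: [:: 1; 2]; [:: 1; 3]; [:: 2; 4]]%N) uidx).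
- exact: (uniq_all_size uidx allidx).
- move=> u u0; split; last by left.
  by right; apply: u0; rewrite !inE !negb_or !(idx_neq uidx).
- exact: toric_chain1 If1 f10.
- exact: generators_size_gt0 If1 f10.
- by exists f1.
Qed.

Lemma fam2_ci : bases_up_to_relabel M fam2 -> complete_intersection I.
Proof.
move=> /relabel_indices [] // p [idx [uidx allidx psurj pE img]].
pose j12 := idx [:: 1; 2]%N; pose j34 := idx [:: 3; 4]%N.
pose j13 := idx [:: 1; 3]%N; pose j24 := idx [:: 2; 4]%N; pose j14 := idx [:: 1; 4]%N.
have im1 : mon_image (U_(j12) + U_(j34))%MM = mon_image (U_(j13) + U_(j24))%MM.
  exact: (family_binomial psurj pE).
pose f1 : R := 'X_[U_(j12) + U_(j34)] - 'X_[U_(j13) + U_(j24)].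
have If1 : I f1 by apply: toric_idealX.
have f10 : f1 <> 0 by apply: binomial_neq0; rewrite !(idx_neq uidx).
have u4 : uniq [:: j12; j34; j13; j24].
  exact: (idx_uniq (l := [:: [:: 1; 2]; [:: 3; 4]; [:: 1; 3]; [:: 2; 4]]%N) uidx).
apply: (@ci_of_reduction k M p j12 j34 j13 j24 (fun u => u j14) (fun _ => 0%N) _ _
  [:: f1] 1 [:: j12; j13; j24; j14]) => //.
- move=> u; split; rewrite img !big_cons big_nil inordK // !inE /= !(mul1n, mul0n, addn0, add0n);
    by rewrite ?addnA.
- move=> u v e1 e2 e3 e4 e5 _; apply/mnmP=> j; have := allidx j.
  by rewrite !inE => /or4P[||| /orP[]] /eqP ->.
- by move=> g; rewrite inE => /eqP ->.
- move=> u; have [u' [uu' r1 _]] := exchange_step u (span_ideal_is_ideal [:: f1])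
    (span_ideal_nth (gs := [:: f1]) (i := 0) isT) u4.
  by exists u' => //; split=> //; right.
- exact: (idx_uniq (l := [:: [:: 1; 2]; [:: 1; 3]; [:: 2; 4]; [:: 1; 4]]%N) uidx).
- exact: (uniq_all_size uidx allidx).
- move=> u u0; split; last by right.
  by right; apply: u0; rewrite !inE !negb_or !(idx_neq uidx).
- exact: toric_chain1 If1 f10.
- exact: generators_size_gt0 If1 f10.
- by exists f1.
Qed.

Lemma fam3_ci : bases_up_to_relabel M fam3 -> complete_intersection I.
Proof.
move=> /relabel_indices [] // p [idx [uidx allidx psurj pE img]].
pose j12 := idx [:: 1; 2]%N; pose j34 := idx [:: 3; 4]%N.
pose j13 := idx [:: 1; 3]%N; pose j24 := idx [:: 2; 4]%N.
pose j14 := idx [:: 1; 4]%N; pose j23 := idx [:: 2; 3]%N.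
have im1 : mon_image (U_(j12) + U_(j34))%MM = mon_image (U_(j13) + U_(j24))%MM.
  exact: (family_binomial psurj pE).
have im2 : mon_image (U_(j14) + U_(j23))%MM = mon_image (U_(j13) + U_(j24))%MM.
  exact: (family_binomial psurj pE).
pose f1 : R := 'X_[U_(j12) + U_(j34)] - 'X_[U_(j13) + U_(j24)].
pose f2 : R := 'X_[U_(j14) + U_(j23)] - 'X_[U_(j13) + U_(j24)].
have If1 : I f1 by apply: toric_idealX.
have If2 : I f2 by apply: toric_idealX.
have f10 : f1 <> 0 by apply: binomial_neq0; rewrite !(idx_neq uidx).
have u4 : uniq [:: j12; j34; j13; j24].
  exact: (idx_uniq (l := [:: [:: 1; 2]; [:: 3; 4]; [:: 1; 3]; [:: 2; 4]]%N) uidx).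
have u4' : uniq [:: j14; j23; j13; j24].
  exact: (idx_uniq (l := [:: [:: 1; 4]; [:: 2; 3]; [:: 1; 3]; [:: 2; 4]]%N) uidx).
have ne14 L : L \in fam3 -> L != [:: 1; 4]%N -> (idx L == j14) = false.
  by move=> Lf L14; rewrite (negbTE (idx_neq uidx Lf _ L14)).
have ne12 L : L \in fam3 -> L != [:: 1; 2]%N -> (idx L == j12) = false.
  by move=> Lf L12; rewrite (negbTE (idx_neq uidx Lf _ L12)).
apply: (@ci_of_reduction k M p j12 j34 j13 j24 (fun u => u j14) (fun u => u j23) _ _
  [:: f1; f2] 2 [:: j12; j13; j24; j14]) => //.
- move=> u; split; rewrite img !big_cons big_nil inordK // !inE /= !(mul1n, mul0n, addn0, add0n);
    by rewrite ?addnA.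
- move=> u v e1 e2 e3 e4 e5 e6; apply/mnmP=> j; have := allidx j.
  by rewrite !inE => /or4P[||| /or3P[]] /eqP ->.
- by move=> g; rewrite !inE => /orP[] /eqP ->.
- move=> u; have idJ := span_ideal_is_ideal [:: f1; f2]; have [_ JD _] := idJ.
  have [u' [uu' r1 _]] := exchange_step u idJ
    (span_ideal_nth (gs := [:: f1; f2]) (i := 0) isT) u4.
  have [v [u'v r2 same]] := exchange_step u' idJ
    (span_ideal_nth (gs := [:: f1; f2]) (i := 1) isT) u4'.
  exists v; first by rewrite -(subrK 'X_[u'] 'X_[u]) -addrA; apply: JD.
  (* The second rewriting does not touch [j12] and [j34], so the first reduction persists. *)
  split=> //; case: r1 => r1; [left|right];
    by rewrite same // !inE !negb_or !(idx_neq uidx).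
- exact: (idx_uniq (l := [:: [:: 1; 2]; [:: 1; 3]; [:: 2; 4]; [:: 1; 4]]%N) uidx).
- exact: (uniq_all_size uidx allidx).
- move=> u u0; split; right; apply: u0; by rewrite !inE !negb_or !(idx_neq uidx).
(* The variable [j14] is absent from the first binomial and occurs on one side only of the
   second. *)
- apply: (@toric_chain2 k M j14 _ _ _ _ im1 im2 _ _ f10).
    by rewrite !mnmDE !mnm1E !ne14.
  by rewrite !mnmDE !mnm1E eqxx !ne14.
(* Two generators are needed because the two exponent differences are independent in any
   characteristic, as the entries at [j12] and [j14] show. *)
- move=> gs' gen; pose u (i : 'I_2) := if i == 0 then (U_(j12) + U_(j34))%MM
    else (U_(j14) + U_(j23))%MM.
  apply: (generators_size_ge hr _ (u := u) (v := fun _ => (U_(j13) + U_(j24))%MM) gen) => //.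
    by rewrite /u => i; case: eqP.
  apply: inj_row_free => w w0.
  have /rowP/(_ j12) := w0; have /rowP/(_ j14) := w0.
  rewrite !mxE !big_ord_recl !big_ord0 !mxE /u /= !mnmDE !mnm1E !eqxx !ne12 // !ne14 //=.
  rewrite !subrr !mulr0 !subr0 !mulr1 !addr0 !add0r => w1 w0'.
  by apply/rowP=> -[[|[|//]] lt]; rewrite mxE; [rewrite -w0'|rewrite -w1]; congr (w 0 _);
    apply: val_inj.
- by exists f1.
Qed.

End Families.

Theorem theorem2p3 (k : fieldType) (n r : nat) (M : matroid n) :
  has_rank M r ->
  (forall e, ~ is_loop M e) ->
  (forall e, ~ is_coloop M e) ->
  (2 <= r)%N -> (r <= n - 1)%N ->
  complete_intersection (@toric_ideal k n M) <->
  n = 4%N /\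
  [\/ bases_up_to_relabel M fam1,
      bases_up_to_relabel M fam2 |
      bases_up_to_relabel M fam3].
Proof.
move=> hr nl nc r2 rn; have r0 : (0 < r)%N by apply: leq_trans r2.
split=> [ci | [n4 fam]]; last first.
  (* All three families contain the pair 1, 2, which fixes the rank. *)
  subst n; have r_2 : r = 2%N.
    have [s BM] : exists s : {perm 'I_4},
        [set i : 'I_4 | (val (s i)).+1 \in [:: 1; 2]%N] \in bases M.
      by case: fam => -[s Hs]; exists s; rewrite Hs; apply/hasP; exists [:: 1; 2]%N.
    have E : [set i : 'I_4 | (val (s i)).+1 \in [:: 1; 2]%N] =
        [set (s^-1)%g (inord 0); (s^-1)%g (inord 1)].
      apply/setP=> i; rewrite !inE -!(inj_eq (@perm_inj _ s) i) !permKV -!val_eqE.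
      by rewrite /= !inordK.
    by apply/eqP; rewrite eqn_leq r2 andbT -(hr _ BM) E cards2; case: (_ != _).
  subst r; case: fam => [/fam1_ci|/fam2_ci|/fam3_ci]; exact.
(* Corank one would make the toric ideal zero, which the definition of a complete intersection rules
   out. *)
have r2n : (r + 2 <= n)%N.
  have [x [Ix x0]] := ci.1; rewrite leqNgt; apply/negP => lt.
  by apply: x0; apply: toric_ideal_corank1 hr r0 _ Ix; lia.
have n4 : n = 4%N.
  suff : (n < 5)%N by lia.
  rewrite ltnNge; apply/negP => n5.
  exact: segre_grid_not_ci hr r0 (exists_segre_grid hr nl nc r2 r2n n5) ci.
subst n; have r_2 : r = 2%N by lia.
by subst r; split=> //; apply: rank2_on4_classification.
Qed.
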